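(* Let $\zeta>0$ be small, $0<\eta<1$, $0<\epsilon<1/2$. Assume $\delta=\Theta\left(\sqrt{1-p_r(I,I')}\right)$, $\delta>0$, and that $p_r(I,I')$ is close enough to $1$. Let $d=\Theta(D^{-1}\mathrm{polylog}(p_0^{-1}\delta^{-1}))$, $q=\Theta(p_0\delta^2)$, $$J=\lceil\log_2(1/\epsilon)\rceil+1,\qquad \tau_j=2^{\,j-1-\lceil\log_2(1/\epsilon)\rceil}\,\frac{\delta}{N\epsilon}\quad(1\le j\le J),$$ and $$NN_s=\Omega\left(p_0^{-2}\delta^{-(2+\zeta)}\mathrm{polylog}\left(\log(\zeta^{-1})\log(\epsilon^{-1})D^{-1}\eta^{-1}p_0^{-1}\right)\right),$$ $$\min\{N,N_s\}=\Omega\left(p_0^{-2}\mathrm{polylog}\left(\log(\epsilon^{-1})D^{-1}\eta^{-1}\right)\right).$$ Let $\theta^*$ be the output of the filtered multi-level QCELS algorithm (see context) with these parameters. Then $$\mathbb{P}\left(\left|(\theta^*-\lambda_0)\ \mathrm{mod}\ [-\pi,\pi)\right|<\epsilon\right)\ge1-\eta ,\qquad \epsilon=\frac{\delta}{N\tau_J}.$$ In particular, to construct the loss functions, the maximal evolution time is $T_{\max}=d+\delta/\epsilon$, and (with $NN_s$ taken of the order of its lower bound above) the total evolution time is $$T_{\mathrm{total}}=\Theta\left(p_0^{-2}\delta^{-(2+\zeta)}\mathrm{polylog}\left(\log(\zeta^{-1})\log(\epsilon^{-1})D^{-1}\eta^{-1}p_0^{-1}\right)\left(d+\delta/\epsi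lon\right)\right).$$
   Context: Setting. $H$ is a Hermitian operator on a finite-dimensional complex Hilbert space with an orthonormal eigenbasis $|\psi_m\rangle$, $0\le m\le M-1$, and eigenvalues $\lambda_m\in[-\pi,\pi]$; $\lambda_0\in[-\pi,\pi)$ is the smallest eigenvalue. $|\psi\rangle$ is a unit vector, $p_m=|\langle\psi_m|\psi\rangle|^2$, $p_0>0$. $I\subset I'\subset[-\pi,\pi]$ are intervals with $\lambda_0\in I$, at positive distance $D=\mathrm{dist}([-\pi,\pi]\setminus I',I)=\min_{x_1\in[-\pi,\pi]\setminus I',\,x_2\in I}|x_1-x_2|$. The relative overlap is $p_r(I,I')=p_0\,\mathbf 1_I(\lambda_0)\big/\sum_{\lambda_k\in I'}p_k$, where $\mathbf 1_I$ is the indicator function of $I$. Filter. $F_q(x)=\sum_{l=-d}^d\hat F_{l,q}e^{ilx}$ is a trigonometric polynomial of degree $d$ with $|F_q(x)-1|\le q$ for $x\in I$, $|F_q(x)|\le q$ for $x\in[-\pi,\pi]\setminus I'$, $|\hat F_{l,q}|=\Theta(|l|^{-1})$ (for $l\ne0$), and $\mathcal F:=\sum_{l=-d}^d|\hat F_{l,q}|=\Theta(\log d)$; it is the polynomial furnished by the Fourier-filter construction of Lin and Tong (PRX Quantum 3, 010318, 2022, Lemma 6). Write $\hat F_{l,q}=|\hat F_{l,q}|e^{i\phi_{l,q}}$ and $\beta_l=|\hat F_{l,q}|/\mathcal F$. Filtered data with time step $\tau$: for integers $N,N_s\ge1$ and each $(k,n)$, $1\le k\le N_s$, $0\le n\le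 N-1$, independently draw $l\in\{-d,\dots,d\}$ with $\mathbb{P}(l)=\beta_l$; given $l$, draw independent $\{\pm1\}$-valued $\widetilde X_{k,n},\widetilde Y_{k,n}$ (each the outcome of one circuit run) with conditional means the real and imaginary parts of $\langle\psi|e^{-i(n\tau-l)H}|\psi\rangle$; put $Z_{k,n,q}=(\widetilde X_{k,n}+i\widetilde Y_{k,n})e^{i\phi_{l,q}}\mathcal F$ and $Z_{n,q}=\frac1{N_s}\sum_{k=1}^{N_s}Z_{k,n,q}$ (so $\mathbb{E}Z_{n,q}=\langle\psi|F_q(H)e^{-in\tau H}|\psi\rangle$). Filtered multi-level QCELS algorithm (QCELS: quantum complex exponential least squares): start with $\lambda_{\min}=-\pi$, $\lambda_{\max}=\pi$. For $j=1,\dots,J$: generate fresh independent filtered data with time step $\tau_j$; let $(r_j^*,\theta_j^* )$ minimize the loss function $\frac1N\sum_{n=0}^{N-1}|Z_{n,q}-re^{-i\theta n\tau_j}|^2$ over $r\in\mathbb{C}$, $\theta\in[\lambda_{\min},\lambda_{\max}]$; set $\lambda_{\min}=\theta_j^*-\frac\pi{2\tau_j}$, $\lambda_{\max}=\theta_j^*+\frac\pi{2\tau_j}$. Output $\theta^*=\theta_J^*$. Costs: a circuit run for index $n$ at level $j$ is charged evolution time $d+n\tau_j$; the maximal evolution time $T_{\max}$ of a single run is counted with $N\tau_J=\delta/\epsilon$ in place of $(N-1)\tau_J$, and the total evolution time $T_{\mathrm{total}}$ is the sum of the evolution times over all circuit runs. Notation: $x\ \mathrm{mod}\ [-a,a)$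 is the representative in $[-a,a)$ of $x$ modulo $2a$. Asymptotic convention: the assertion is that there are suitable constants (those implicit in $\Omega$, $\Theta$, ''small'', ''close enough'', and exponents in $\mathrm{polylog}$), independent of the other parameters, for which it holds. A hypothesis $A=\Omega(B)$ means $A\ge CB$ with $C$ large enough; $A=\Theta(B)$ means $cB\le A\le c'B$, where for $\delta$ the lower constant is suitably large and for $q$ the upper constant is suitably small; $\mathrm{polylog}(x_1x_2\cdots)$ denotes a fixed power of $2+\sum_i|\log x_i|$, where the power may differ between occurrences.
   Formalization: Two repairs: how close p_r must be to 1 may depend on ζ (a threshold uniform in ζ fails, e.g. δ=e^{-1/ζ}); and the upper bound on T_total has Jd+δ/ε in place of d+δ/ε, since summing over the J levels exceeds the stated bound, e.g. for ε=δ→0. *)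

(* Defs.v *)
From HB Require Import structures.
From mathcomp Require Import all_boot all_order all_algebra.
From mathcomp Require Import complex.
From mathcomp Require Import all_classical all_reals all_analysis.

Set Implicit Arguments.
Unset Strict Implicit.
Unset Printing Implicit Defensive.

Import Order.TTheory GRing.Theory Num.Theory.
Import numFieldNormedType.Exports.

Local Open Scope classical_set_scope.
Local Open Scope ring_scope.
Local Open Scope complex_scope.
Local Open Scope sesquilinear_scope.

Section Scalars.
Context {R : realType}.
Implicit Types (x a : R) (z : R[i]).

(* The norm [`|z|] of [R[i]] is valued in [R[i]]; this is the same number as an
   element of [R]. *)
Definition cabs z : R := ComplexField.Normc.normc z.

Definition expi x : R[i] := cos x +i* sin x.

(* The representative in [-a, a) of x modulo 2a. *)
Definition symmod a x : R := x - 2 * a * (Num.floor ((x + a) / (2 * a)))%:~R.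

(* A fixed power of 2 + |log x_1| + |log x_2| + ..., which is the meaning given
   to polylog (x_1 x_2 ...). *)
Definition polylog (k : R) (xs : seq R) : R :=
  (2 + \sum_(x <- xs) `|ln x|) `^ k.

End Scalars.

Section Spectral.
Context {R : realType} (M : nat).
Implicit Types (H : 'M[R[i]]_M.+1) (psi : 'cV[R[i]]_M.+1)
  (v : 'I_M.+1 -> 'cV[R[i]]_M.+1) (lam : 'I_M.+1 -> R).

Definition braket (u w : 'cV[R[i]]_M.+1) : R[i] := (u^t* *m w) 0 0.

Definition eigenbasis H v lam : Prop :=
  (forall m m', braket (v m) (v m') = (m == m')%:R) /\
  (forall m, H *m v m = (lam m)%:C *: v m).

(* Functional calculus: f(H) = sum_m f(lam_m) |v_m><v_m| for an operator H with
   orthonormal eigenbasis v and eigenvalues lam. *)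
Definition opfun v lam (f : R -> R[i]) : 'M[R[i]]_M.+1 :=
  \sum_m f (lam m) *: (v m *m (v m)^t*).

(* <psi| exp(-itH) |psi> *)
Definition evol_amp v lam psi (t : R) : R[i] :=
  braket psi (opfun v lam (fun x => expi (- (t * x))) *m psi).

Definition overlap v psi (m : 'I_M.+1) : R := cabs (braket (v m) psi) ^+ 2.

Definition relative_overlap v lam psi (I I' : set R) : R :=
  overlap v psi ord0 * \1_I (lam ord0) /
    \sum_(k | lam k \in I') overlap v psi k.

End Spectral.

(* [inf] of the empty set is 0, so [0 < gap I I'] forces [-pi, pi] \ I' to be
   nonempty. An infimum, since the minimum need not be attained when the
   intervals are not suitably open or closed. *)
Definition gap {R : realType} (I I' : set R) : R :=
  inf [set `|x1 - x2| | x1 in `[- pi, pi]%classic `\` I' & x2 in I].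

Section Filter.
Context {R : realType} (d : nat).
Implicit Types (Fhat : 'I_(d.*2.+1) -> R[i]).

(* Position s = 0, ..., 2d stands for the frequency l = s - d. *)
Definition freq (s : 'I_(d.*2.+1)) : R := s%:R - d%:R.

Definition trig_eval Fhat (x : R) : R[i] :=
  \sum_s Fhat s * expi (freq s * x).

Definition coef_norm Fhat : R := \sum_s cabs (Fhat s).

(* [ff_bound] is implied by the global bound -q <= F <= 1 + q that comes with
   the Lin-Tong polynomials, which are mollified indicator functions; it is the
   only control of the filter on I' \ I.  The pairs (a, a') and (b, b') are the
   constants of |F^_l| = Theta(1/|l|) and sum_l |F^_l| = Theta(log d). *)
Record fourier_filter (I I' : set R) (q a a' b b' : R) Fhat : Prop := {
  ff_pass : forall x, I x -> cabs (trig_eval Fhat x - 1) <= q ;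
  ff_stop : forall x, - pi <= x <= pi -> ~ I' x ->
    cabs (trig_eval Fhat x) <= q ;
  ff_bound : forall x, - pi <= x <= pi -> cabs (trig_eval Fhat x) <= 1 + q ;
  ff_coef : forall s, freq s != 0 ->
    a / `|freq s| <= cabs (Fhat s) <= a' / `|freq s| ;
  ff_sum : b * ln d%:R <= coef_norm Fhat <= b' * ln d%:R }.

End Filter.

Section Schedule.
Context {R : realType}.
Variables (delta eps : R) (N : nat).

Definition log2_ceil : int := Num.ceil (ln eps^-1 / ln 2).

Definition levels : nat := (absz log2_ceil).+1.

(* Levels are numbered from 1. *)
Definition tau (j : nat) : R :=
  2 ^ (j%:Z - 1 - log2_ceil) * (delta / (N%:R * eps)).

End Schedule.

Section Data.
Context {R : realType} (d J Ns N : nat).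

(* A shot (s, x, y) records the drawn frequency and the two outcomes; the
   booleans stand for the signs [pm x] and [pm y].  Level j = i.+1 is indexed
   by i : 'I_J. *)
Definition shot : finType := ('I_(d.*2.+1) * bool * bool)%type.

Definition sample : finType := {ffun 'I_J * 'I_Ns * 'I_N -> shot}.

Definition pm (x : bool) : R := if x then 1 else - 1.

Variables (Fhat : 'I_(d.*2.+1) -> R[i]) (phi : 'I_(d.*2.+1) -> R).
(* [amp t] stands for <psi| exp(-itH) |psi> *)
Variables (amp : R -> R[i]) (step : nat -> R).

(* P(l) = |F^_l| / sum |F^|; the {-1, 1}-valued outcome with mean m takes the
   value x with probability (1 + x m) / 2. *)
Definition shot_pmf (j n : nat) (w : shot) : R :=
  let: (s, x, y) := w in
  let m := amp (n%:R * step j - freq s) in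
  cabs (Fhat s) / coef_norm Fhat *
    ((1 + pm x * complex.Re m) / 2) * ((1 + pm y * complex.Im m) / 2).

Definition sample_pmf (w : sample) : R :=
  \prod_(i : 'I_J) \prod_(k : 'I_Ns) \prod_(n : 'I_N)
    shot_pmf i.+1 n (w (i, k, n)).

Definition prob (E : pred sample) : R := \sum_(w | E w) sample_pmf w.

Definition shot_value (w : shot) : R[i] :=
  let: (s, x, y) := w in
  (pm x +i* pm y) * expi (phi s) * (coef_norm Fhat)%:C.

Definition filtered_data (w : sample) (i : 'I_J) (n : 'I_N) : R[i] :=
  (Ns%:R^-1)%:C * \sum_(k : 'I_Ns) shot_value (w (i, k, n)).

End Data.

Section Algorithm.
Context {R : realType} (N : nat).

Definition loss (Z : 'I_N -> R[i]) (t : R) (r : R[i]) (theta : R) : R :=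
  N%:R^-1 * \sum_(n < N) cabs (Z n - r * expi (- (theta * n%:R * t))) ^+ 2.

Definition loss_argmin (Z : 'I_N -> R[i]) (t lo hi : R)
    (r : R[i]) (theta : R) : Prop :=
  lo <= theta <= hi /\
  forall r' theta', lo <= theta' <= hi -> loss Z t r theta <= loss Z t r' theta'.

Variables (step : nat -> R) (theta : nat -> R).

Definition lambda_min (j : nat) : R :=
  if (j <= 1)%N then - pi else theta j.-1 - pi / (2 * step j.-1).

Definition lambda_max (j : nat) : R :=
  if (j <= 1)%N then pi else theta j.-1 + pi / (2 * step j.-1).

(* (r j, theta j), 1 <= j <= J, are minimizers successively found on the data
   Z; the output is [theta J]. *)
Definition qcels_run (J : nat) (Z : 'I_J -> 'I_N -> R[i]) (r : nat -> R[i]) :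
    Prop :=
  forall i : 'I_J, loss_argmin (Z i) (step i.+1)
    (lambda_min i.+1) (lambda_max i.+1) (r i.+1) (theta i.+1).

End Algorithm.

Section Costs.
Context {R : realType}.
Variables (d J Ns N : nat) (step : nat -> R).

(* At each level, n * tau_j <= (N - 1) * tau_j is counted as N * tau_j. *)
Definition T_max : R := \big[Num.max/0]_(i < J) (d%:R + N%:R * step i.+1).

(* Each (k, n) uses two circuit runs, one for each of the two outcomes. *)
Definition T_total : R :=
  \sum_(i < J) \sum_(k < Ns) \sum_(n < N) 2 * (d%:R + n%:R * step i.+1).

End Costs.

(* The expressions inside the two Omega hypotheses, with polylog exponent k. *)
Definition product_bound {R : realType} (k p0 delta zeta eps D eta : R) : R :=
  p0 ^- 2 * delta `^ (- (2 + zeta)) *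
    polylog k [:: ln zeta^-1; ln eps^-1; D^-1; eta^-1; p0^-1].

Definition min_bound {R : realType} (k p0 eps D eta : R) : R :=
  p0 ^- 2 * polylog k [:: ln eps^-1; D^-1; eta^-1].

(* Main.v *)
Require Import Defs.
From mathcomp Require Import all_boot all_order all_algebra.
From mathcomp Require Import complex.
From mathcomp Require Import all_classical all_reals all_analysis.
From mathcomp Require Import ring lra zify.

(** Minimizing the loss over [r] turns QCELS into the maximization of
  |m(x)|, where m(x) = (1/N) sum_n Y_n exp(i n x), x = (theta - lambda_0) tau_j
  and Y_n = Z_n exp(i lambda_0 n tau_j) = p_0 + e_n + xi_n.  The deterministic
  error e_n is O(p_0 delta^2), because the filter suppresses the spectrum
  outside I' and the relative overlap bounds the weight left in I'.  For the
  Dirichlet kernel, 1 - |D(x)| >= c min(1, N x)^2, so comparing |m| at its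
  maximum and at 0 gives p_0 (N x)^2 <= C N x gamma, i.e. N x <= C gamma / p_0,
  where gamma bounds |(1/N) sum_(n >= m) (e_n + xi_n)| for every m (summation
  by parts) and a bound C p_0 on the whole Fourier mean excludes far maxima.
  Chernoff bounds for these tails and for the values on a grid of x, with
  gamma of order p_0 delta, cost N Ns ~ p_0^-2 delta^-2 F^2 log(...), and the
  logarithms of 1/delta are absorbed by delta^-zeta once p_r is close to 1.
  Finally N tau_1 <= delta starts the induction over levels: each search
  interval is one period of x around an estimate already accurate to
  O(delta / (N tau_(j-1))), so no aliasing occurs. *)

Set Implicit Arguments.
Unset Strict Implicit.
Unset Printing Implicit Defensive.

Import Order.TTheory GRing.Theory Num.Theory.
Import numFieldNormedType.Exports.
Local Open Scope classical_set_scope.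
Local Open Scope ring_scope.
Local Open Scope complex_scope.

(** * Real-valued modulus, real and imaginary parts, and phases *)

Section ComplexModulus.
Context {R : realType}.
Implicit Types (x y : R) (z w : R[i]).

Lemma cabs_normE z : (cabs z)%:C = `|z|.
Proof. by rewrite normc_def; case: z. Qed.

Lemma cabsE z : cabs z ^+ 2 = complex.Re z ^+ 2 + complex.Im z ^+ 2.
Proof. by case: z => x y /=; rewrite sqr_sqrtr // addr_ge0 ?sqr_ge0. Qed.

Lemma cabs_ge0 z : 0 <= cabs z.
Proof. by case: z => x y; rewrite sqrtr_ge0. Qed.

Lemma cabs0 : cabs (0 : R[i]) = 0. Proof. exact: ComplexField.Normc.normc0. Qed.
Lemma cabsM z w : cabs (z * w) = cabs z * cabs w.
Proof. exact: ComplexField.Normc.normcM. Qed.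
Lemma cabsN z : cabs (- z) = cabs z.
Proof. by case: z => x y; rewrite /cabs /= !sqrrN. Qed.
Lemma cabsD z w : cabs (z + w) <= cabs z + cabs w.
Proof. by rewrite -lecR rmorphD /= !cabs_normE ler_normD. Qed.
Lemma cabsB z w : cabs (z - w) <= cabs z + cabs w.
Proof. by rewrite -(cabsN w) cabsD. Qed.

Lemma cabs_real x : cabs x%:C = `|x|.
Proof. by rewrite /cabs /= expr0n addr0 sqrtr_sqr. Qed.

Lemma cabs_sum (I : Type) (r : seq I) (P : pred I) (F : I -> R[i]) :
  cabs (\sum_(i <- r | P i) F i) <= \sum_(i <- r | P i) cabs (F i).
Proof.
elim/big_ind2: _ => [|z1 x1 z2 x2 h1 h2|//]; first by rewrite cabs0.
exact: le_trans (cabsD _ _) (lerD h1 h2).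
Qed.

Lemma ReD z w : complex.Re (z + w) = complex.Re z + complex.Re w.
Proof. by case: z w => [? ?] []. Qed.
Lemma ImD z w : complex.Im (z + w) = complex.Im z + complex.Im w.
Proof. by case: z w => [? ?] []. Qed.
Lemma ReN z : complex.Re (- z) = - complex.Re z. Proof. by case: z. Qed.
Lemma ImN z : complex.Im (- z) = - complex.Im z. Proof. by case: z. Qed.
Lemma ReM z w :
  complex.Re (z * w) =
    complex.Re z * complex.Re w - complex.Im z * complex.Im w.
Proof. by case: z w => [? ?] []. Qed.
Lemma ImM z w :
  complex.Im (z * w) =
    complex.Re z * complex.Im w + complex.Im z * complex.Re w.
Proof. by case: z w => [? ?] []. Qed.

Lemma Re_sum (I : Type) (r : seq I) (P : pred I) (F : I -> R[i]) :
  complex.Re (\sum_(i <- r | P i) F i) = \sum_(i <- r | P i) complex.Re (F i).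
Proof. exact: (big_morph _ ReD). Qed.

Lemma Im_sum (I : Type) (r : seq I) (P : pred I) (F : I -> R[i]) :
  complex.Im (\sum_(i <- r | P i) F i) = \sum_(i <- r | P i) complex.Im (F i).
Proof. exact: (big_morph _ ImD). Qed.

Lemma eq_Re_Im z w : complex.Re z = complex.Re w ->
  complex.Im z = complex.Im w -> z = w.
Proof. by case: z w => [? ?] [? ?] /= -> ->. Qed.

Lemma normr_Re_le z : `|complex.Re z| <= cabs z.
Proof.
rewrite -(ler_pXn2r (ltn0Sn 1)) ?nnegrE ?cabs_ge0 //.
by rewrite cabsE real_normK ?num_real // lerDl sqr_ge0.
Qed.

Lemma normr_Im_le z : `|complex.Im z| <= cabs z.
Proof.
rewrite -(ler_pXn2r (ltn0Sn 1)) ?nnegrE ?cabs_ge0 //.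
by rewrite cabsE real_normK ?num_real // lerDr sqr_ge0.
Qed.

Lemma cabs_le_Re_Im z : cabs z <= `|complex.Re z| + `|complex.Im z|.
Proof.
rewrite -(ler_pXn2r (ltn0Sn 1)) ?nnegrE ?cabs_ge0 ?addr_ge0 //.
rewrite cabsE -(real_normK (num_real (complex.Re z))).
rewrite -(real_normK (num_real (complex.Im z))).
by rewrite sqrrD lerD2r lerDl mulrn_wge0 // mulr_ge0.
Qed.

Lemma cabs_expi x : cabs (expi x) = 1.
Proof. by rewrite /expi /cabs /= cos2Dsin2 sqrtr1. Qed.

Lemma expiD x y : expi (x + y) = expi x * expi y.
Proof. by rewrite /expi cosD sinD [sin x * _ + _]addrC. Qed.

Lemma expi0 : expi (0 : R) = 1.
Proof. by rewrite /expi cos0 sin0. Qed.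

Lemma expiNK x : expi (- x) * expi x = 1.
Proof. by rewrite -expiD addNr expi0. Qed.

Lemma cabs_natr n : cabs (n%:R : R[i]) = n%:R.
Proof.
have -> : n%:R = (n%:R : R)%:C by rewrite rmorph_nat.
by rewrite cabs_real ger0_norm.
Qed.

Lemma cabs_natrV n : cabs ((n%:R)^-1 : R[i]) = n%:R^-1.
Proof. by rewrite -cabs_natr; exact: ComplexField.Normc.normcV. Qed.

End ComplexModulus.

(** * Polynomial bounds on sine and cosine *)

Section TrigBounds.
Context {R : realType}.
Implicit Types (x y a : R) (f df : R -> R).

(** Mean value theorem on [[0, x]]. Applied three times in a row, each Taylor bound on sine or
    cosine supplies the sign of the next derivative. *)
Lemma ge0_of_derive_ge0 f df : (forall x, is_derive x 1 f (df x)) ->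
  f 0 = 0 -> (forall x, 0 <= x -> 0 <= df x) -> forall x, 0 <= x -> 0 <= f x.
Proof.
move=> fE f0 df_ge0 x x0.
have fc : {within `[0, x], continuous f}.
  by apply: derivable_within_continuous => y _; have [] := fE y.
have [y] := MVT_segment x0 (fun y _ => fE y) fc.
rewrite in_itv /= => /andP[y0 _]; rewrite f0 !subr0 => ->.
by rewrite mulr_ge0 ?df_ge0.
Qed.

Lemma sin_le x : 0 <= x -> sin x <= x.
Proof.
move=> x0; rewrite -subr_ge0.
apply: (@ge0_of_derive_ge0 (fun y => y - sin y) (fun y => 1 - cos y)) x0.
- by rewrite /= sin0 subr0.
- by move=> y _; rewrite subr_ge0 cos_le1.
Qed.

Lemma cos_ge x : 1 - x ^+ 2 / 2 <= cos x.
Proof.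
wlog x0 : x / 0 <= x => [hw|].
  have [/hw//|/ltW x0] := leP 0 x.
  by rewrite -cosN -sqrrN hw // oppr_ge0.
rewrite -subr_ge0.
apply: (@ge0_of_derive_ge0 (fun y => cos y - (1 - y ^+ 2 / 2))
  (fun y => y - sin y)) x0; last first.
- by move=> y y0; rewrite subr_ge0 sin_le.
- by rewrite cos0 expr0n /= mul0r subr0 subrr.
- by move=> y; apply: is_derive_eq; rewrite /GRing.scale /=; field.
Qed.

Lemma sin_ge x : 0 <= x -> x - x ^+ 3 / 6 <= sin x.
Proof.
move=> x0; rewrite -subr_ge0.
apply: (@ge0_of_derive_ge0 (fun y => sin y - (y - y ^+ 3 / 6))
  (fun y => cos y - (1 - y ^+ 2 / 2))) x0; last first.
- by move=> y y0; rewrite subr_ge0 cos_ge.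
- by rewrite sin0 expr0n /= mul0r !subr0.
- by move=> y; apply: is_derive_eq; rewrite /GRing.scale /=; field.
Qed.

Lemma sin_ge_third x : 0 <= x <= 2 -> x / 3 <= sin x.
Proof.
move=> /andP[x0 x2]; apply: le_trans _ (sin_ge x0).
have : x * x ^+ 2 <= x * 4 by rewrite ler_wpM2l //; nra.
by rewrite -exprS; lra.
Qed.

(** Half-angle formula and [sin y >= y / 3] on [[0, 2]]. The range 4 exceeds pi on purpose: offsets
    slightly beyond half a period have to be covered. *)
Lemma one_sub_cos_ge x : `|x| <= 4 -> x ^+ 2 / 18 <= 1 - cos x.
Proof.
move=> x4; rewrite -cos_norm -(real_normK (num_real x)).
have x0 := normr_ge0 x; move: `|x| x0 x4 => y y0 y4.
have -> : 1 - cos y = 2 * sin (y / 2) ^+ 2.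
  have -> : cos y = cos ((y / 2) *+ 2) by congr cos; field.
  by rewrite cos_mulr2n cos2sin2 -[_ *+ 2]mulr_natl; ring.
have : y / 2 / 3 <= sin (y / 2).
  by apply: sin_ge_third; rewrite divr_ge0 // ler_pdivrMr //; lra.
by nra.
Qed.

Lemma cabs_expi_sub1_le x : cabs (expi x - 1) <= `|x|.
Proof.
rewrite -(ler_pXn2r (ltn0Sn 1)) ?nnegrE ?cabs_ge0 // cabsE.
rewrite real_normK ?num_real // ReD ImD ReN ImN /= oppr0 addr0.
have := cos2Dsin2 x; have := cos_ge x; nra.
Qed.

Lemma cabs_expi_sub_le x y : cabs (expi x - expi y) <= `|x - y|.
Proof.
have -> : expi x - expi y = expi y * (expi (x - y) - 1).
  by rewrite mulrBr mulr1 -expiD [y + _]addrC subrK.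
by rewrite cabsM cabs_expi mul1r cabs_expi_sub1_le.
Qed.

End TrigBounds.

(** * Size of the Dirichlet kernel near its peak and away from it *)

Section DirichletKernel.
Context {R : realType} (N : nat).
Implicit Types (x y a : R).

Definition center (n : nat) : R := n%:R - (N%:R - 1) / 2.

(* The Dirichlet kernel with its phase removed: it is real since the centred
   indices are symmetric about 0. *)
Definition cos_mean x : R := N%:R^-1 * \sum_(n < N) cos (x * center n).

(** The shift [a] is free because [center] depends on [N], which would block an induction on the
    number of terms. *)
Lemma sum_sqr_sub_nat a m :
  \sum_(n < m) (n%:R - a) ^+ 2 =
  m%:R * (m%:R - 1) * (2 * m%:R - 1) / 6 - a * m%:R * (m%:R - 1) + m%:R * a ^+ 2.
Proof.
elim: m => [|m IH]; first by rewrite big_ord0 !mul0r mulr0 mul0r subrr addr0.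
by rewrite big_ord_recr /= IH -natr1; field.
Qed.

Lemma sum_sqr_center :
  \sum_(n < N) center n ^+ 2 = N%:R * (N%:R ^+ 2 - 1) / 12.
Proof. by rewrite sum_sqr_sub_nat; field. Qed.

(** Multiplying by [2 sin (x / 2)] turns each cosine into a difference of sines at half-integer
    shifts, and the sum telescopes. *)
Lemma sum_cos_sub_nat x a m :
  2 * sin (x / 2) * \sum_(n < m) cos (x * (n%:R - a)) =
  sin (x * (m%:R - a - 2^-1)) + sin (x * (a + 2^-1)).
Proof.
elim: m => [|m IH].
  rewrite big_ord0 mulr0 -[X in _ + sin X]opprK sinN.
  by rewrite (_ : x * _ = - (x * (a + 2^-1))) ?subrr //; ring.
rewrite big_ord_recr /= mulrDr IH -[m.+1%:R]natr1.
have -> : x * (m%:R + 1 - a - 2^-1) = x * (m%:R - a) + x / 2 by field.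
have -> : x * (m%:R - a - 2^-1) = x * (m%:R - a) - x / 2 by field.
by rewrite sinB sinD; ring.
Qed.

(** The closed form sin(N x / 2) / (N sin(x / 2)), multiplied out so that zeros of the denominator
    need no exclusion. *)
Lemma sin_half_cos_mean x : (0 < N)%N ->
  N%:R * sin (x / 2) * cos_mean x = sin (N%:R * x / 2).
Proof.
move=> N0; have N0' : N%:R != 0 :> R by rewrite pnatr_eq0 -lt0n.
have := sum_cos_sub_nat x ((N%:R - 1) / 2) N.
rewrite (_ : x * (_ - _ - _) = N%:R * x / 2); last by field.
rewrite (_ : x * (_ + _) = N%:R * x / 2); last by field.
rewrite /cos_mean /center => h; apply: (mulfI (_ : 2 != 0 :> R)) => //.
rewrite [RHS](_ : _ = sin (N%:R * x / 2) + sin (N%:R * x / 2)); last by ring.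
by rewrite -h; field.
Qed.

Lemma mean_expi x :
  (N%:R)^-1 * \sum_(n < N) expi (n%:R * x) =
  expi ((N%:R - 1) / 2 * x) * (cos_mean x)%:C.
Proof.
(* Reversing the indices negates [center], so the odd part cancels. *)
have sin_sum0 : \sum_(n < N) sin (x * center n) = 0.
  have : \sum_(n < N) sin (x * center n) = - \sum_(n < N) sin (x * center n).
    rewrite {1}(reindex_inj rev_ord_inj) /= -sumrN; apply: eq_bigr => n _.
    rewrite -sinN -mulrN; congr (sin (x * _)).
    by rewrite /center natrB // -[n.+1%:R]natr1; field.
  by move=> h; lra.
have -> : \sum_(n < N) expi (n%:R * x) = expi ((N%:R - 1) / 2 * x) *
    (\sum_(n < N) cos (x * center n))%:C.
  have -> : (\sum_(n < N) cos (x * center n))%:C =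
      \sum_(n < N) expi (x * center n).
    by apply: eq_Re_Im; rewrite ?Re_sum ?Im_sum /= ?sin_sum0.
  rewrite mulr_sumr; apply: eq_bigr => n _; rewrite -expiD; congr expi.
  by rewrite /center; field.
rewrite mulrCA; congr (_ * _).
by rewrite rmorphM /= fmorphV rmorph_nat.
Qed.

(** Averages [one_sub_cos_ge], as [|x * center n| <= N |x| / 2 <= 4]. The mean of [center n ^+ 2] is
    (N^2 - 1) / 12, at least N^2 / 16 for N >= 2, and 288 = 16 * 18. *)
Lemma cos_mean_le x : (1 < N)%N -> N%:R * `|x| <= 8 ->
  cos_mean x <= 1 - (N%:R * x) ^+ 2 / 288.
Proof.
move=> N2 Nx.
have N2' : 2 <= N%:R :> R by rewrite ler_nat.
have N0 : 0 < N%:R :> R by lra.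
rewrite /cos_mean ler_pdivrMl //.
apply: (@le_trans _ _ (\sum_(n < N) (1 - (x * center n) ^+ 2 / 18))).
  apply: ler_sum => n _; rewrite lerBrDr addrC -lerBrDr.
  apply: one_sub_cos_ge; rewrite normrM.
  apply: (@le_trans _ _ (`|x| * (N%:R / 2))); last by lra.
  rewrite ler_wpM2l // ler_norml /center.
  have : 0 <= n%:R :> R by [].
  have : n%:R + 1 <= N%:R :> R by rewrite natr1 ler_nat.
  by lra.
rewrite sumrB sumr_const card_ord -mulr_suml.
under [X in _ - X / _]eq_bigr do rewrite exprMn.
rewrite -mulr_sumr sum_sqr_center exprMn -subr_ge0.
set X := x ^+ 2; set K := N%:R ^+ 2.
have X0 : 0 <= X by exact: sqr_ge0.
have K4 : 4 <= K by rewrite /K; nra.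
have -> : N%:R * (1 - K * X / 288) - (1 *+ N - X * (N%:R * (K - 1) / 12) / 18) =
    N%:R * X * (K - 4) / 864 by field.
have NX : 0 <= N%:R * X by rewrite mulr_ge0 // ltW.
move: (N%:R * X) NX => Y Y0; clear -Y0 K4; move: K K4 => K K4.
rewrite -subr_ge0 in K4; have YK := mulr_ge0 Y0 K4.
by apply: divr_ge0; [exact: YK | exact: ler0n].
Qed.

(** Up to the first zero, at N |x| = 2 pi, both sines of the closed form have the same sign. *)
Lemma cos_mean_ge0 x : (1 < N)%N -> `|x| <= 4 -> N%:R * `|x| <= 2 * pi ->
  0 <= cos_mean x.
Proof.
wlog x0 : x / 0 <= x => [hw N1 x4 Nx|].
  have [x0|/ltW x0] := leP 0 x; first exact: hw.
  have -> : cos_mean x = cos_mean (- x).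
    by congr (_ * _); apply: eq_bigr => n _; rewrite mulNr cosN.
  by apply: hw; rewrite ?normrN ?oppr_ge0.
rewrite ger0_norm // => N1 x4 Nx.
have N0 : 0 < N%:R :> R by rewrite ltr0n ltnW.
have [->|xn0] := eqVneq x 0.
  by rewrite mulr_ge0 ?invr_ge0 ?sumr_ge0 // => n _; rewrite mul0r cos0.
have xp : 0 < x by rewrite lt_def xn0.
have sp : 0 < sin (x / 2).
  apply: lt_le_trans _ (sin_ge_third _); last by lra.
  by rewrite !divr_gt0.
rewrite -(pmulr_rge0 _ (_ : 0 < N%:R * sin (x / 2))) ?mulr_gt0 //.
rewrite sin_half_cos_mean 1?ltnW //; apply: sin_ge0_pi.
by apply/andP; split; [rewrite divr_ge0 ?mulr_ge0 // ltW| lra].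
Qed.

(** In the closed form the numerator is at most 1 in modulus, while N sin(x / 2) >= 4/3. *)
Lemma cos_mean_far x : (1 < N)%N -> `|x| <= 4 -> 2 * pi <= N%:R * `|x| ->
  `|cos_mean x| <= 3 / 4.
Proof.
wlog x0 : x / 0 <= x => [hw N1 x4 Nx|].
  have [x0|/ltW x0] := leP 0 x; first exact: hw.
  have -> : cos_mean x = cos_mean (- x).
    by congr (_ * _); apply: eq_bigr => n _; rewrite mulNr cosN.
  by apply: hw; rewrite ?normrN ?oppr_ge0.
rewrite ger0_norm // => N1 x4 Nx.
have N2 : 2 <= N%:R :> R by rewrite ler_nat.
have sp : 4 / 3 <= N%:R * sin (x / 2).
  have y0 : 0 <= x / 2 by rewrite divr_ge0.
  have y2 : x / 2 <= 2 by lra.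
  have Ny : 2 <= N%:R * (x / 2) by have := @pi_ge2 R; lra.
  have := sin_ge y0; rewrite exprS.
  move: (x / 2) (sin _) y0 y2 Ny => y s y0 y2 Ny hs.
  (* For y <= 1, sin y >= 5 y / 6 and N y >= 2 give 5/3. For 1 < y <= 2 the cubic bound gives sin y
     >= 2/3, and N >= 2 gives 4/3. *)
  have [y1|y1] := leP y 1.
    have y3 : y * y ^+ 2 <= y * 1 by apply: ler_wpM2l => //; nra.
    have : N%:R * (5 / 6 * y) <= N%:R * s by apply: ler_wpM2l; lra.
    by lra.
  have h : 2 / 3 <= s.
    apply: le_trans hs; rewrite -subr_ge0.
    have -> : y - y * y ^+ 2 / 6 - 2 / 3 = (2 - y) * (y ^+ 2 + 2 * y - 2) / 6.
      by field.
    by rewrite divr_ge0 // mulr_ge0 //; nra.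
  have : 2 * s <= N%:R * s by rewrite ler_wpM2r //; lra.
  by lra.
have s0 : 0 < N%:R * sin (x / 2) by lra.
have : N%:R * sin (x / 2) * `|cos_mean x| <= 1.
  by rewrite -{1}(gtr0_norm s0) -normrM sin_half_cos_mean 1?ltnW // sin_max.
by have := normr_ge0 (cos_mean x); nra.
Qed.

End DirichletKernel.

(** * Stability of the peak of a constant signal under small errors *)

Section PeakStability.
Context {R : realType} (N : nat).
Implicit Types (x p t gam : R) (Y e : 'I_N -> R[i]).

Definition fourier_mean Y x : R[i] :=
  (N%:R)^-1 * \sum_(n < N) Y n * expi (n%:R * x).

Lemma fourier_meanD Y e x :
  fourier_mean (fun n => Y n + e n) x = fourier_mean Y x + fourier_mean e x.
Proof.
rewrite /fourier_mean -mulrDr -big_split /=; congr (_ * _).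
by apply: eq_bigr => n _; rewrite mulrDl.
Qed.

Lemma fourier_mean_const p x : fourier_mean (fun=> p%:C) x =
  expi ((N%:R - 1) / 2 * x) * (p * cos_mean N x)%:C.
Proof.
rewrite /fourier_mean -mulr_sumr mulrCA mean_expi mulrCA.
by rewrite [(p * _)%:C]rmorphM.
Qed.

Lemma cos_mean0 : (0 < N)%N -> cos_mean N (0 : R) = 1.
Proof.
move=> N0; rewrite /cos_mean.
under eq_bigr do rewrite mul0r cos0.
by rewrite sumr_const card_ord mulVf // pnatr_eq0 -lt0n.
Qed.

(** Removing [t] from a dominant real part [p] lowers the squared modulus by at least 7 p t / 9,
    while the two moduli add up to at most 29 p / 9; the modulus thus drops by at least 7 t / 29. *)
Lemma cabs_shift_decrease p t H (g : R[i]) : 0 < p -> 0 <= t <= p ->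
  cabs g <= p / 9 -> cabs (p%:C + g) <= cabs (p%:C + g - t%:C) + H ->
  t <= 5 * H.
Proof.
move=> p0 /andP[t0 tp] gp.
have ha : cabs (p%:C + g) <= 10 / 9 * p.
  by apply: le_trans (cabsD _ _) _; rewrite cabs_real gtr0_norm //; lra.
have hb : cabs (p%:C + g - t%:C) <= 19 / 9 * p.
  by apply: le_trans (cabsB _ _) _; rewrite cabs_real ger0_norm //; lra.
have ab : cabs (p%:C + g) ^+ 2 - cabs (p%:C + g - t%:C) ^+ 2 =
    t * (2 * (p + complex.Re g) - t).
  by rewrite !cabsE !ReD !ImD !ReN !ImN /=; ring.
have ure : - (p / 9) <= complex.Re g.
  by have := le_trans (normr_Re_le g) gp; rewrite ler_norml => /andP[].
have := cabs_ge0 (p%:C + g); have := cabs_ge0 (p%:C + g - t%:C).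
move: (cabs (p%:C + g)) (cabs (p%:C + g - t%:C)) ha hb ab => a b ha hb ab b0 a0 hH.
have h1 : 7 / 9 * p * t <= t * (2 * (p + complex.Re g) - t).
  rewrite [_ * t]mulrC; apply: ler_wpM2l => //. lra.
rewrite -ab in h1.
(* A negative [H] would make the modulus grow, against [h1]. *)
have [H0|H0] := leP 0 H; last first.
  have : a ^+ 2 < b ^+ 2 by rewrite ltr_pXn2r ?nnegrE //; lra.
  have : 0 <= p * t by rewrite mulr_ge0 // ltW.
  by lra.
have h2 : a ^+ 2 - b ^+ 2 <= H * (29 / 9 * p).
  rewrite subr_sqr; apply: (@le_trans _ _ (H * (a + b))).
    by apply: ler_wpM2r; lra.
  by apply: ler_wpM2l; lra.
have : p * (7 / 9 * t) <= p * (29 / 9 * H) by lra.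
by rewrite ler_pM2l //; lra.
Qed.

(* The phase of the Dirichlet kernel is moved onto the error, which costs
   [N |x| / 2] times the error at 0. *)
Lemma peak_stability p gam e x : (1 < N)%N -> 0 < p -> `|x| <= 4 ->
  cabs (fourier_mean e x) <= p / 9 ->
  cabs (fourier_mean e 0) <= gam -> gam <= p / 9 ->
  cabs (fourier_mean e x - fourier_mean e 0) <= N%:R * `|x| * gam ->
  cabs (fourier_mean (fun n => p%:C + e n) 0) <=
    cabs (fourier_mean (fun n => p%:C + e n) x) ->
  N%:R * `|x| * p <= 2160 * gam.
Proof.
move=> N1 p0 x4 gx g0 gamp gx0.
have N0 : 0 < N%:R :> R by rewrite ltr0n ltnW.
rewrite !fourier_meanD !fourier_mean_const cos_mean0 1?ltnW //.
rewrite mulr0 expi0 mul1r mulr1.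
set al := (N%:R - 1) / 2 * x.
move: (fourier_mean e x) (fourier_mean e 0) gx g0 gx0 => G G0 gx g0 gx0.
have gam0 : 0 <= gam by apply: le_trans g0; exact: cabs_ge0.
have -> : expi al * (p * cos_mean N x)%:C + G =
    expi al * ((p * cos_mean N x)%:C + expi (- al) * G).
  by rewrite mulrDr mulrA -expiD subrr expi0 mul1r.
rewrite cabsM cabs_expi mul1r.
(* Beyond the first zero of the kernel its modulus is at most 3/4. *)
have [far|near] := leP (2 * pi) (N%:R * `|x|).
  have Dx := cos_mean_far N1 x4 far => h.
  have h1 : p - gam <= cabs (p%:C + G0).
    have : cabs ((p%:C + G0) - G0) <= cabs (p%:C + G0) + cabs G0 by exact: cabsB.
    by rewrite addrK cabs_real gtr0_norm //; lra.
  have h2 : cabs ((p * cos_mean N x)%:C + expi (- al) * G) <= p * (3 / 4) + p / 9.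
    apply: le_trans (cabsD _ _) _; rewrite cabs_real cabsM cabs_expi mul1r.
    by apply: lerD => //; rewrite normrM gtr0_norm // ler_pM2l.
  (* The margin is narrow: p - p/9 = 32 p / 36 against 3 p / 4 + p / 9 = 31 p / 36. *)
  by exfalso; lra.
have pi4 : N%:R * `|x| <= 8 by have := @pihalf_lt2 R; lra.
have D0 := cos_mean_ge0 N1 x4 (ltW near).
have D1 := cos_mean_le N1 pi4.
(* The value at [x] is the value at 0, minus the loss [t] of the kernel, plus the change [h] of the
   error. Maximality plays [t], quadratic in N |x|, against [h], linear in it. *)
set t := p * (1 - cos_mean N x).
set h := expi (- al) * G - G0.
have -> : (p * cos_mean N x)%:C + expi (- al) * G = (p%:C + G0 - t%:C) + h.
  have -> : (p * cos_mean N x)%:C = p%:C - t%:C :> R[i].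
    by rewrite -rmorphB /t /=; congr (_%:C); ring.
  by rewrite /h; ring.
move=> hle.
have al_le : `|al| <= N%:R * `|x| / 2.
  rewrite /al normrM ger0_norm; last first.
    by rewrite divr_ge0 // subr_ge0 ler1n ltnW.
  by rewrite mulrAC ler_pM2r // ler_wpM2r //; lra.
have h_le : cabs h <= 3 / 2 * (N%:R * `|x|) * gam.
  have -> : h = expi (- al) * (G - G0) + (expi (- al) - 1) * G0.
    by rewrite /h; ring.
  apply: le_trans (cabsD _ _) _; rewrite !cabsM cabs_expi mul1r.
  have : cabs (expi (- al) - 1) * cabs G0 <= N%:R * `|x| / 2 * gam.
    apply: ler_pM => //; try exact: cabs_ge0.
    by apply: le_trans (cabs_expi_sub1_le _) _; rewrite normrN.
  by lra.
have t_ge : p * ((N%:R * x) ^+ 2 / 288) <= t.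
  by rewrite /t ler_pM2l //; lra.
have t0 : 0 <= t <= p.
  apply/andP; split; last by rewrite /t ger_pMr //; lra.
  apply: le_trans t_ge; apply: mulr_ge0; first exact: ltW.
  by apply: divr_ge0; [exact: sqr_ge0|exact: ler0n].
have tle : t <= 5 * cabs h.
  apply: (cabs_shift_decrease p0 t0 (le_trans g0 gamp)).
  exact: le_trans hle (cabsD _ _).
(* 2160 = 288 * 5 * 3/2, from the curvature of the kernel, [cabs_shift_decrease] and [h_le]. One
   factor N |x| then cancels unless it is 0. *)
have : p * ((N%:R * x) ^+ 2) <= 2160 * ((N%:R * `|x|) * gam) by lra.
have -> : (N%:R * x) ^+ 2 = (N%:R * `|x|) * (N%:R * `|x|).
  by rewrite -expr2 !exprMn real_normK ?num_real.
have : 0 <= N%:R * `|x| by rewrite mulr_ge0 // ltW.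
move: (N%:R * `|x|) => y; rewrite le_eqVlt => /orP[/eqP <- _|y0].
  by lra.
have -> : p * (y * y) = y * (y * p) by ring.
have -> : 2160 * (y * gam) = y * (2160 * gam) by ring.
by rewrite ler_pM2l.
Qed.

End PeakStability.

(** * Bounds on Fourier means, and the loss as a Fourier mean *)

Section FourierMeanBounds.
Context {R : realType} (N : nat).
Implicit Types (x y t B : R) (r : R[i]) (Z e : 'I_N -> R[i]) (u : nat -> R[i]).

(** Covers Fourier modes and indicators of tails alike, so that one concentration bound serves
    both. *)
Definition weighted_mean u e : R[i] := (N%:R)^-1 * \sum_(n < N) e n * u n.

Lemma weighted_mean_le u e B : (0 < N)%N ->
  (forall n : 'I_N, cabs (e n * u n) <= B) -> cabs (weighted_mean u e) <= B.
Proof.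
move=> N0 h; rewrite /weighted_mean cabsM cabs_natrV ler_pdivrMl ?ltr0n //.
apply: le_trans (cabs_sum _ _ _) _.
apply: le_trans (ler_sum _ (fun n _ => h n)) _.
by rewrite sumr_const card_ord mulr_natl.
Qed.

Lemma fourier_mean_le e B x : (0 < N)%N ->
  (forall n, cabs (e n) <= B) -> cabs (fourier_mean e x) <= B.
Proof.
move=> N0 h; apply: (weighted_mean_le (u := fun n => expi (n%:R * x))) => // n.
by rewrite cabsM cabs_expi mulr1.
Qed.

Lemma fourier_mean_lipschitz e B x y : (0 < N)%N ->
  (forall n, cabs (e n) <= B) ->
  cabs (fourier_mean e x - fourier_mean e y) <= N%:R * `|x - y| * B.
Proof.
move=> N0 h.
have -> : fourier_mean e x - fourier_mean e y =
    weighted_mean (fun n => expi (n%:R * x) - expi (n%:R * y)) e.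
  rewrite /fourier_mean /weighted_mean -mulrBr -sumrB; congr (_ * _).
  by apply: eq_bigr => n _; rewrite mulrBr.
apply: weighted_mean_le => // n; rewrite cabsM mulrC.
apply: ler_pM => //; try exact: cabs_ge0.
apply: le_trans (cabs_expi_sub_le _ _) _.
rewrite -mulrBr normrM ger0_norm // ler_wpM2r // ler_nat.
exact: ltnW.
Qed.

(** Summation by parts: exp(i n x) - 1 telescopes into increments of modulus at most |x|, and the
    increment at [m] multiplies the tail of [e] after [m]. *)
Lemma fourier_mean_abel e B x : (0 < N)%N -> 0 <= B ->
  (forall m : 'I_N,
    cabs (weighted_mean (fun n => (m <= n)%N%:R) e) <= B) ->
  cabs (fourier_mean e x - fourier_mean e 0) <= N%:R * `|x| * B.
Proof.
move=> N0 B0 h.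
pose c (m : nat) : R[i] := expi (m.+1%:R * x) - expi (m%:R * x).
have -> : fourier_mean e x - fourier_mean e 0 =
    \sum_(m < N) c m * weighted_mean (fun n => (m.+1 <= n)%N%:R) e.
  rewrite /fourier_mean /weighted_mean -mulrBr -sumrB.
  rewrite [RHS](eq_bigr (fun m : 'I_N =>
    N%:R^-1 * \sum_(n < N) e n * (c m * (m < n)%N%:R))); last first.
    move=> m _; rewrite mulrCA mulr_sumr; congr (_ * _).
    by apply: eq_bigr => n _; rewrite mulrCA.
  rewrite -mulr_sumr exchange_big /=; congr (_ * _).
  apply: eq_bigr => n _; rewrite -mulrBr -mulr_sumr; congr (_ * _).
  have -> : expi (n%:R * x) - expi (n%:R * 0) = \sum_(0 <= m < n) c m.
    by rewrite (telescope_sumr (fun m => expi (m%:R * x))) // mul0r mulr0.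
  rewrite (big_nat_widen _ _ _ _ _ (ltnW (ltn_ord n))) big_mkord.
  rewrite big_mkcond /=; apply: eq_bigr => m _.
  by case: ifP => _; rewrite ?mulr1 ?mulr0.
apply: le_trans (cabs_sum _ _ _) _.
apply: (@le_trans _ _ (\sum_(m < N) `|x| * B)); last first.
  by rewrite sumr_const card_ord -[_ *+ N]mulr_natl mulrA.
apply: ler_sum => m _; rewrite cabsM; apply: ler_pM; try exact: cabs_ge0.
  apply: le_trans (cabs_expi_sub_le _ _) _.
  by rewrite -mulrBl -[m.+1%:R]natr1 addrAC subrr add0r mul1r.
(* The last increment meets the empty tail, which has no index in ['I_N]. *)
have [mN|mN] := ltnP m.+1 N; first exact: (h (Ordinal mN)).
rewrite /weighted_mean big1 ?mulr0 ?cabs0 // => n _.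
by rewrite leqNgt (leq_trans (ltn_ord n) mN) mulr0.
Qed.

(** Moves the frequency [lam] to 0, so that the wanted component of the signal becomes constant. *)
Definition dephased lam t Z (n : 'I_N) : R[i] := Z n * expi (lam * n%:R * t).

(** Completing the square in [r]: the best [r] is the Fourier mean at [th], and minimizing what
    remains means maximizing the modulus of that mean. *)
Lemma lossE Z t r th : (0 < N)%N ->
  loss Z t r th = N%:R^-1 * \sum_(n < N) cabs (Z n) ^+ 2
    - cabs (weighted_mean (fun n => expi (th * n%:R * t)) Z) ^+ 2
    + cabs (r - weighted_mean (fun n => expi (th * n%:R * t)) Z) ^+ 2.
Proof.
move=> N0; set m := weighted_mean _ _.
have expand (a b w : R[i]) : cabs w = 1 ->
    cabs (a * w - b) ^+ 2 = cabs a ^+ 2 + cabs b ^+ 2 -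
      2 * complex.Re (b^*%C * (a * w)).
  move=> w1; have := cabsE (a * w); rewrite cabsM w1 mulr1 => ->.
  rewrite !cabsE ReD ImD ReN ImN [in RHS]ReM.
  by case: b => b1 b2 /=; ring.
have sq (n : 'I_N) : cabs (Z n - r * expi (- (th * n%:R * t))) ^+ 2 =
    cabs (Z n) ^+ 2 + cabs r ^+ 2 -
    2 * complex.Re (r^*%C * (Z n * expi (th * n%:R * t))).
  rewrite -expand ?cabs_expi //; congr (_ ^+ 2).
  set y := th * n%:R * t.
  have -> : Z n * expi y - r = (Z n - r * expi (- y)) * expi y.
    by rewrite mulrBl -[r * _ * _]mulrA expiNK mulr1.
  by rewrite cabsM cabs_expi mulr1.
rewrite /loss (eq_bigr _ (fun n _ => sq n)) sumrB big_split /=.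
rewrite sumr_const card_ord -mulr_sumr -Re_sum -mulr_sumr.
have -> : \sum_(n < N) Z n * expi (th * n%:R * t) = N%:R * m.
  by rewrite /m /weighted_mean mulVKf // pnatr_eq0 -lt0n.
have := expand m r 1; rewrite -(cabsN (r - m)) opprB.
rewrite -{1}expi0 cabs_expi mulr1 => -> //.
have -> : complex.Re (r^*%C * (N%:R * m)) = N%:R * complex.Re (r^*%C * m).
  have -> : (N%:R : R[i]) = (N%:R : R)%:C by rewrite rmorph_nat.
  by rewrite mulrCA [LHS]ReM [complex.Im _%:C]/= mul0r subr0.
rewrite -[X in _ + X - _]mulr_natl; field.
by rewrite pnatr_eq0 -lt0n.
Qed.

Lemma loss_argmin_fourier_mean Z t lo hi r th lam : (0 < N)%N ->
  loss_argmin Z t lo hi r th -> lo <= lam <= hi ->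
  cabs (fourier_mean (dephased lam t Z) 0) <=
    cabs (fourier_mean (dephased lam t Z) ((th - lam) * t)).
Proof.
move=> N0 [_ h] lam_in.
have wE a : fourier_mean (dephased lam t Z) ((a - lam) * t) =
    weighted_mean (fun n => expi (a * n%:R * t)) Z.
  congr (_ * _); apply: eq_bigr => n _; rewrite /dephased -mulrA -expiD.
  by congr (_ * expi _); ring.
have := wE lam; rewrite subrr mul0r => ->; rewrite wE.
(* The competitor is [lam] with its own optimal [r], whose residual vanishes; the residual of the
   minimizer has the favourable sign. *)
have := h (weighted_mean (fun n => expi (lam * n%:R * t)) Z) lam lam_in.
rewrite !lossE // subrr cabs0 expr0n addr0 => hle.
rewrite -(ler_pXn2r (ltn0Sn 1)) ?nnegrE ?cabs_ge0 //.
have := sqr_ge0 (cabs (r - weighted_mean (fun n => expi (th * n%:R * t)) Z)).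
by lra.
Qed.

End FourierMeanBounds.

(** * A Chernoff bound for finite product distributions *)

Section Chernoff.
Context {R : realType}.

(* From exp x <= (1 - x/2)^-2, itself exp(-x/2) >= 1 - x/2. *)
Lemma expR_le_quadratic (x : R) : `|x| <= 1 / 4 -> expR x <= 1 + x + x ^+ 2.
Proof.
rewrite ler_norml => /andP[x1 x2].
have c0 : 0 < 1 - x / 2 by lra.
have h : 1 - x / 2 <= expR (- (x / 2)) by apply: expR_ge1Dx.
have e1 : expR x * expR (- (x / 2)) ^+ 2 = 1.
  by rewrite expr2 -!expRD -[RHS]expR0; congr expR; field.
have h2 : (1 - x / 2) ^+ 2 <= expR (- (x / 2)) ^+ 2.
  by rewrite ler_pXn2r // ?nnegrE ?expR_ge0 // ltW.
rewrite -(ler_pM2r (_ : 0 < (1 - x / 2) ^+ 2)) ?exprn_gt0 //.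
have := ler_wpM2l (expR_ge0 x) h2; rewrite e1 => h3; apply: le_trans h3 _.
rewrite -subr_ge0.
have -> : (1 + x + x ^+ 2) * (1 - x / 2) ^+ 2 - 1 =
    x ^+ 2 / 4 * (1 - 3 * x + x ^+ 2) by field.
have x0 := sqr_ge0 x.
by apply: mulr_ge0; [apply: divr_ge0|lra].
Qed.

Context (I S : finType) (f X : I -> S -> R) (B : I -> R) (s t : R).
Hypotheses (f_ge0 : forall i x, 0 <= f i x) (f_sum : forall i, \sum_x f i x = 1).
Hypotheses (X_le : forall i x, `|X i x| <= B i).
Hypotheses (s_ge0 : 0 <= s) (sB : forall i, s * B i <= 1 / 4).

Let mean i : R := \sum_x f i x * X i x.

(** The quadratic bound on the exponential integrates to 1 + s mean + s^2 B^2; by [1 + u <= exp u]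
    this goes into an exponent, where centring removes the mean. *)
Lemma mgf_le i :
  \sum_x f i x * expR (s * (X i x - mean i)) <= expR (s ^+ 2 * B i ^+ 2).
Proof.
have -> : \sum_x f i x * expR (s * (X i x - mean i)) =
    expR (- (s * mean i)) * \sum_x f i x * expR (s * X i x).
  rewrite mulr_sumr; apply: eq_bigr => x _.
  by rewrite mulrBr addrC expRD mulrCA.
have h : \sum_x f i x * expR (s * X i x) <= 1 + (s * mean i + s ^+ 2 * B i ^+ 2).
  apply: (@le_trans _ _ (\sum_x (f i x + s * (f i x * X i x)
      + f i x * (s ^+ 2 * B i ^+ 2)))); last first.
    by rewrite !big_split /= -mulr_sumr -mulr_suml f_sum mul1r addrA.
  apply: ler_sum => x _.
  have -> : f i x + s * (f i x * X i x) + f i x * (s ^+ 2 * B i ^+ 2) =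
      f i x * (1 + s * X i x + s ^+ 2 * B i ^+ 2) by ring.
  apply: ler_wpM2l => //.
  have sX : `|s * X i x| <= s * B i.
    by rewrite normrM ger0_norm // ler_wpM2l.
  apply: le_trans (expR_le_quadratic (le_trans sX (sB i))) _.
  rewrite lerD2l -exprMn -real_normK ?num_real //.
  by rewrite ler_pXn2r // ?nnegrE // (le_trans _ sX).
rewrite -[s ^+ 2 * _](addKr (s * mean i)) expRD ler_wpM2l ?expR_ge0 //.
exact: le_trans h (expR_ge1Dx _).
Qed.

(** Exponential Markov inequality; independence is the distributivity of a product of sums over
    functions. Bounds that vary with [i] allow coordinates to be switched off by [B i = 0]. *)
Lemma chernoff :
  \sum_(w : {ffun I -> S} | t <= \sum_i (X i (w i) - mean i)) \prod_i f i (w i)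
  <= expR (s ^+ 2 * (\sum_i B i ^+ 2) - s * t).
Proof.
pose Y (w : {ffun I -> S}) := \sum_i (X i (w i) - mean i).
have pf_ge0 (w : {ffun I -> S}) : 0 <= \prod_i f i (w i) by apply: prodr_ge0.
apply: (@le_trans _ _ (\sum_(w : {ffun I -> S})
    (\prod_i f i (w i)) * (expR (s * Y w) * expR (- (s * t))))).
  rewrite big_mkcond /=; apply: ler_sum => w _; case: ifP => [tY|_].
    rewrite ler_peMr // -expRD -expR0 ler_expR.
    by rewrite -mulrN -mulrDr mulr_ge0 // subr_ge0.
  by rewrite mulr_ge0 // mulr_ge0 // expR_ge0.
under eq_bigr do rewrite mulrA.
rewrite -mulr_suml expRD ler_wpM2r ?expR_ge0 //.
have -> : \sum_(w : {ffun I -> S}) (\prod_i f i (w i)) * expR (s * Y w) =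
    \prod_i \sum_x f i x * expR (s * (X i x - mean i)).
  rewrite bigA_distr_bigA /=; apply: eq_bigr => w _.
  rewrite big_split /=; congr (_ * _).
  by rewrite /Y mulr_sumr expR_sum.
rewrite mulr_sumr expR_sum; apply: ler_prod => i _; apply/andP; split.
  by apply: sumr_ge0 => x _; rewrite mulr_ge0 // expR_ge0.
exact: mgf_le.
Qed.

End Chernoff.

(** * The law of the samples and concentration of the filtered data *)

Lemma big_triple (T : Type) (idx : T) (op : Monoid.com_law idx)
    (A B C : finType) (G : A * B * C -> T) :
  \big[op/idx]_p G p =
  \big[op/idx]_a \big[op/idx]_b \big[op/idx]_c G (a, b, c).
Proof.
rewrite (pair_bigA _ (fun a b => \big[op/idx]_c G (a, b, c))) /=.
rewrite (pair_bigA _ (fun p c => G (p.1, p.2, c))) /=.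
by apply: eq_bigr => -[[a b] c] _.
Qed.

Section Sampling.
Context {R : realType} (d J Ns N : nat).
Variables (Fhat : 'I_(d.*2.+1) -> R[i]) (phi : 'I_(d.*2.+1) -> R).
Variables (amp : R -> R[i]) (step : nat -> R).
Hypothesis F_gt0 : 0 < coef_norm Fhat.
Hypothesis amp_Re : forall t, `|complex.Re (amp t)| <= 1.
Hypothesis amp_Im : forall t, `|complex.Im (amp t)| <= 1.

Local Notation shot := (shot d).
Local Notation sample := (sample d J Ns N).
Local Notation pmf := (shot_pmf Fhat amp step).
Local Notation value := (shot_value Fhat phi).
Local Notation F := (coef_norm Fhat).

Local Notation Pr E := (prob Fhat amp step (E : pred sample)).

Lemma shot_pmf_ge0 j n w : 0 <= pmf j n w.
Proof.
case: w => [[s x] y]; rewrite /shot_pmf /=.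
have h b (m : R) : `|m| <= 1 -> 0 <= (1 + pm b * m) / 2.
  by rewrite ler_norml /pm => /andP[h1 h2]; case: b; apply: divr_ge0; lra.
have A0 : 0 <= cabs (Fhat s) / F by rewrite divr_ge0 ?cabs_ge0 // ltW.
by rewrite mulr_ge0 ?h // mulr_ge0 // h.
Qed.

Lemma big_shot (V : nmodType) (G : shot -> V) : \sum_w G w =
  \sum_s (G (s, true, true) + G (s, true, false) +
          (G (s, false, true) + G (s, false, false))).
Proof.
by rewrite big_triple; apply: eq_bigr => s _; rewrite !big_bool.
Qed.

Lemma shot_pmf_sum1 j n : \sum_w pmf j n w = 1.
Proof.
rewrite big_shot.
rewrite (eq_bigr (fun s => cabs (Fhat s) / F)); last first.
  by move=> s _; rewrite /shot_pmf /= /pm; field; rewrite gt_eqF.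
by rewrite -mulr_suml divff // gt_eqF.
Qed.

(** The expectation of a shot, equal to <psi| F(H) exp(-i n tau H) |psi> when [amp] is the evolution
    amplitude. *)
Definition shot_mean (j n : nat) : R[i] :=
  \sum_s Fhat s * amp (n%:R * step j - freq s).

Hypothesis FE : forall s, Fhat s = (cabs (Fhat s))%:C * expi (phi s).

(** Importance sampling: the factor [coef_norm] and the phase in [shot_value] undo the normalization
    of the law of the frequency. *)
Lemma shot_pmf_mean j n : \sum_w (pmf j n w)%:C * value w = shot_mean j n.
Proof.
rewrite big_shot; apply: eq_bigr => s _; rewrite [in RHS]FE.
rewrite /shot_pmf /shot_value /= /pm; set m := amp _.
have F0 : F != 0 by rewrite gt_eqF.
by apply: eq_Re_Im; rewrite !(ReD, ImD, ReM, ImM) /=; field.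
Qed.

Lemma shot_pmf_mean_Re j n (a : R[i]) :
  \sum_w pmf j n w * complex.Re (a * value w) =
  complex.Re (a * shot_mean j n).
Proof.
rewrite -shot_pmf_mean mulr_sumr Re_sum; apply: eq_bigr => w _.
by rewrite !ReM !ImM /=; ring.
Qed.

Lemma cabs_shot_value w : cabs (value w) <= 2 * F.
Proof.
case: w => [[s x] y]; rewrite /shot_value !cabsM cabs_expi cabs_real.
rewrite mulr1 (gtr0_norm F_gt0) ler_pM2r //.
apply: le_trans (cabs_le_Re_Im _) _ => /=.
by case: x; case: y; rewrite /pm ?normrN normr1.
Qed.

Lemma sample_pmfE (w : sample) : sample_pmf Fhat amp step w =
  \prod_(p : 'I_J * 'I_Ns * 'I_N) pmf p.1.1.+1 p.2 (w p).
Proof.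
by rewrite big_triple.
Qed.

Lemma sample_pmf_ge0 (w : sample) : 0 <= sample_pmf Fhat amp step w.
Proof.
by rewrite sample_pmfE; apply: prodr_ge0 => p _; exact: shot_pmf_ge0.
Qed.

Lemma prob_total : Pr (predT : pred sample) = 1.
Proof.
rewrite /prob; under eq_bigr do rewrite sample_pmfE.
rewrite -(bigA_distr_bigA
  (fun (p : 'I_J * 'I_Ns * 'I_N) (s : shot) => pmf p.1.1.+1 p.2 s)) /=.
by apply: big1 => p _; exact: shot_pmf_sum1.
Qed.

Lemma prob_mono (E E' : pred sample) : subpred E E' ->
  Pr E <= Pr E'.
Proof.
move=> EE'; rewrite /prob [leLHS]big_mkcond [leRHS]big_mkcond /=.
apply: ler_sum => w _; have := EE' w.
by case: (E w) => [->//|_]; case: ifP => // _; exact: sample_pmf_ge0.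
Qed.

Lemma prob_predC (E : pred sample) :
  Pr (predC E) = 1 - Pr E.
Proof.
rewrite -prob_total /prob [X in _ = X - _](bigID E) /=.
by rewrite addrAC subrr add0r.
Qed.

Lemma prob_exists_le (T : finType) (E : T -> pred sample) :
  Pr (fun w => [exists x, E x w]) <=
  \sum_x Pr (E x).
Proof.
rewrite /prob [leLHS]big_mkcond /=; under [leRHS]eq_bigr do rewrite big_mkcond.
rewrite exchange_big /=; apply: ler_sum => w _.
have ge0 (P : pred T) :
    0 <= \sum_(x | P x) (if E x w then sample_pmf Fhat amp step w else 0).
  by apply: sumr_ge0 => x _; case: ifP => // _; exact: sample_pmf_ge0.
case: ifP => [/existsP[x Ex]|_]; last exact: ge0.
by rewrite (bigD1 x) //= Ex lerDl ge0.
Qed.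

Lemma weighted_mean_filtered_data (w : sample) (i : 'I_J) u :
  weighted_mean u (filtered_data Fhat phi w i) =
  ((N * Ns)%:R^-1)%:C * \sum_(k < Ns) \sum_(n < N) u n * value (w (i, k, n)).
Proof.
rewrite exchange_big /=.
have -> : ((N * Ns)%:R^-1 : R)%:C = (N%:R)^-1 * (Ns%:R^-1)%:C.
  by rewrite natrM invfM rmorphM /= fmorphV rmorph_nat.
rewrite -mulrA; congr (_ * _); rewrite mulr_sumr; apply: eq_bigr => n _.
rewrite /filtered_data -mulrA mulr_suml; congr (_ * _).
by apply: eq_bigr => k _; rewrite mulrC.
Qed.

Lemma weighted_mean_shot_mean (i : 'I_J) u : (0 < Ns)%N ->
  weighted_mean u (fun n : 'I_N => shot_mean i.+1 n) =
  ((N * Ns)%:R^-1)%:C * \sum_(k < Ns) \sum_(n < N) u n * shot_mean i.+1 n.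
Proof.
move=> Ns0; rewrite sumr_const card_ord -[X in _ * X]mulr_natl mulrA.
have -> : ((N * Ns)%:R^-1 : R)%:C * Ns%:R = (N%:R)^-1.
  rewrite natrM invfM rmorphM /= !fmorphV !rmorph_nat -mulrA mulVf ?mulr1 //.
  by rewrite pnatr_eq0 -lt0n.
by congr (_ * _); apply: eq_bigr => n _; rewrite mulrC.
Qed.

(** [chernoff] over all levels at once, with [X] and [B] vanishing off level [i], so that only N Ns
    coordinates count. *)
Lemma deviation_Re_le (i : 'I_J) (u : nat -> R[i]) t :
  (0 < N)%N -> (0 < Ns)%N -> (forall n, cabs (u n) <= 1) ->
  0 <= t -> t <= F ->
  Pr (fun w => t <= complex.Re (weighted_mean u (filtered_data Fhat phi w i)
     - weighted_mean u (fun n : 'I_N => shot_mean i.+1 n)))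
  <= expR (- ((N * Ns)%:R * t ^+ 2 / (16 * F ^+ 2))).
Proof.
move=> N0 Ns0 u1 t0 tF.
have K0 : 0 < (N * Ns)%:R :> R by rewrite ltr0n muln_gt0 N0.
pose X (p : 'I_J * 'I_Ns * 'I_N) (s : shot) : R :=
  if p.1.1 == i then complex.Re (u p.2 * value s) else 0.
pose B (p : 'I_J * 'I_Ns * 'I_N) : R := if p.1.1 == i then 2 * F else 0.
pose f (p : 'I_J * 'I_Ns * 'I_N) s := pmf p.1.1.+1 p.2 s.
have f0 p s : 0 <= f p s by exact: shot_pmf_ge0.
have f1 p : \sum_s f p s = 1 by exact: shot_pmf_sum1.
have XB p s : `|X p s| <= B p.
  rewrite /X /B; case: ifP => _; last by rewrite normr0.
  apply: le_trans (normr_Re_le _) _; rewrite cabsM -[leRHS]mul1r.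
  by apply: ler_pM => //; rewrite ?cabs_ge0 // cabs_shot_value.
(* The minimizer of N Ns (4 F^2 s^2 - s t); [t <= F] is what keeps [s * (2 * F)] below 1/4. *)
pose s := t / (8 * F ^+ 2).
have F2 : 0 < 8 * F ^+ 2 by rewrite mulr_gt0 // exprn_gt0.
have s0 : 0 <= s by rewrite divr_ge0 // ltW.
have sB p : s * B p <= 1 / 4.
  rewrite /B; case: ifP => _; last by rewrite mulr0; lra.
  have -> : s * (2 * F) = t / F / 4 by rewrite /s; field; rewrite gt_eqF.
  by rewrite ler_pM2r ?invr_gt0 // ler_pdivrMr // mul1r.
have sumE (V : zmodType) (G : 'I_Ns -> 'I_N -> V) :
    \sum_(p : 'I_J * 'I_Ns * 'I_N) (if p.1.1 == i then G p.1.2 p.2 else 0) =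
    \sum_k \sum_n G k n.
  rewrite big_triple (bigD1 i) //= [X in _ + X]big1 ?addr0; last first.
    by move=> j /negPf ji; apply: big1 => k _; rewrite ji big1.
  by rewrite eqxx.
have := @chernoff R _ _ f X B s ((N * Ns)%:R * t) f0 f1 XB s0 sB.
have -> : \sum_p B p ^+ 2 = (N * Ns)%:R * (4 * F ^+ 2).
  rewrite (eq_bigr (fun p : 'I_J * 'I_Ns * 'I_N =>
     if p.1.1 == i then 4 * F ^+ 2 else 0)); last first.
    by move=> p _; rewrite /B; case: ifP => _; [ring|rewrite expr0n].
  rewrite (sumE _ (fun _ _ => 4 * F ^+ 2)) !sumr_const !card_ord -mulrnA.
  by rewrite -[LHS]mulr_natl.
have -> : s ^+ 2 * ((N * Ns)%:R * (4 * F ^+ 2)) - s * ((N * Ns)%:R * t) =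
   - ((N * Ns)%:R * t ^+ 2 / (16 * F ^+ 2)).
  by rewrite /s; field; rewrite gt_eqF.
apply: le_trans; rewrite /prob le_eqVlt; apply/orP; left; apply/eqP.
apply: eq_big => [w|w _]; last by rewrite sample_pmfE.
have -> : \sum_p (X p (w p) - \sum_s0 f p s0 * X p s0) =
   (N * Ns)%:R * complex.Re (weighted_mean u (filtered_data Fhat phi w i)
     - weighted_mean u (fun n : 'I_N => shot_mean i.+1 n)).
  rewrite weighted_mean_filtered_data weighted_mean_shot_mean // -mulrBr.
  rewrite ReM /= mul0r subr0 mulVKf ?gt_eqF //.
  rewrite -sumrB Re_sum.
  transitivity (\sum_(k < Ns) \sum_(n < N) (complex.Re (u n * value (w (i, k, n))) -
       complex.Re (u n * shot_mean i.+1 n))); last first.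
    apply: eq_bigr => k _; rewrite -sumrB Re_sum.
    by apply: eq_bigr => n _; rewrite ReD ReN.
  rewrite -sumE; apply: eq_bigr => -[[j k] n] _ /=; rewrite /X /f /=.
  case: (eqVneq j i) => [->|_]; first by rewrite shot_pmf_mean_Re.
  by rewrite big1 ?subrr // => s1 _; rewrite mulr0.
by rewrite ler_pM2l.
Qed.

(** A modulus above 2 t forces the real or the imaginary part above t in absolute value; the four
    signed cases are real parts after a rotation of [u]. *)
Lemma deviation_le (i : 'I_J) (u : nat -> R[i]) t :
  (0 < N)%N -> (0 < Ns)%N -> (forall n, cabs (u n) <= 1) ->
  0 <= t -> t <= F ->
  Pr (fun w => 2 * t < cabs (weighted_mean u (filtered_data Fhat phi w i)
     - weighted_mean u (fun n : 'I_N => shot_mean i.+1 n)))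
  <= 4 * expR (- ((N * Ns)%:R * t ^+ 2 / (16 * F ^+ 2))).
Proof.
move=> N0 Ns0 u1 t0 tF.
(* The four rotations 1, -1, i and -i. *)
pose c (b : bool * bool) : R[i] := (pm b.1)%:C * (if b.2 then 1 else - 'i%C).
have c1 b : cabs (c b) = 1.
  apply/eqP; rewrite -(@eqrXn2 _ 2) ?cabs_ge0 ?ler01 // cabsE expr1n /c.
  by case: b => [[] []]; rewrite /= /pm; apply/eqP; ring.
have wmZ a (e : 'I_N -> R[i]) :
    weighted_mean (fun n => a * u n) e = a * weighted_mean u e.
  rewrite /weighted_mean [RHS]mulrCA; congr (_ * _); rewrite mulr_sumr.
  by apply: eq_bigr => n _; rewrite mulrCA.
pose E b (w : sample) := t <= complex.Re
  (weighted_mean (fun n => c b * u n) (filtered_data Fhat phi w i)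
     - weighted_mean (fun n => c b * u n) (fun n : 'I_N => shot_mean i.+1 n)).
apply: (@le_trans _ _ (Pr (fun w => [exists b, E b w]))).
  apply: prob_mono => w; rewrite /E.
  set D := _ - weighted_mean u _ => tD; apply/existsP.
  have ED b : weighted_mean (fun n => c b * u n) (filtered_data Fhat phi w i)
     - weighted_mean (fun n => c b * u n) (fun n : 'I_N => shot_mean i.+1 n)
     = c b * D.
    by rewrite !wmZ -mulrBr.
  have hb b : t < complex.Re (c b * D) -> exists b, E b w.
    by move=> /ltW h; exists b; rewrite /E ED.
  have := cabs_le_Re_Im D.
  have [h1|h1] := ltP t (complex.Re D).
    by move=> _; apply: (hb (true, true)); rewrite /c mulr1 mul1r.
  have [h2|h2] := ltP t (- complex.Re D).
    by move=> _; apply: (hb (false, true)); rewrite /c mulr1 ReM /= /pm; lra.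
  have [h3|h3] := ltP t (complex.Im D).
    by move=> _; apply: (hb (true, false)); rewrite /c /= /pm !ReM !ImM /=; lra.
  have [h4|h4] := ltP t (- complex.Im D).
    by move=> _; apply: (hb (false, false)); rewrite /c /= /pm !ReM !ImM /=; lra.
  have k1 : `|complex.Re D| <= t by rewrite ler_norml; lra.
  have k2 : `|complex.Im D| <= t by rewrite ler_norml; lra.
  by lra.
apply: le_trans (prob_exists_le _) _.
apply: (@le_trans _ _ (\sum_(b : bool * bool)
    expR (- ((N * Ns)%:R * t ^+ 2 / (16 * F ^+ 2))))).
  apply: ler_sum => b _; apply: (@deviation_Re_le i (fun n => c b * u n)) => // n.
  by rewrite cabsM c1 mul1r.
by rewrite sumr_const card_prod card_bool -[X in X <= _]mulr_natl.
Qed.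

(** The weights are fixed before any data are drawn, so the dependence of later search intervals on
    earlier levels does no harm. *)
Lemma deviation_union_le (T : finType) (u : 'I_J -> T -> nat -> R[i]) t :
  (0 < N)%N -> (0 < Ns)%N -> (forall i x n, cabs (u i x n) <= 1) ->
  0 <= t -> t <= F ->
  1 - 4 * (J * #|T|)%:R * expR (- ((N * Ns)%:R * t ^+ 2 / (16 * F ^+ 2))) <=
  Pr (fun w => [forall i : 'I_J, forall x : T,
    cabs (weighted_mean (u i x) (filtered_data Fhat phi w i)
     - weighted_mean (u i x) (fun n : 'I_N => shot_mean i.+1 n)) <= 2 * t]).
Proof.
move=> N0 Ns0 u1 t0 tF.
pose E (p : 'I_J * T) (w : sample) := 2 * t <
  cabs (weighted_mean (u p.1 p.2) (filtered_data Fhat phi w p.1)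
     - weighted_mean (u p.1 p.2) (fun n : 'I_N => shot_mean p.1.+1 n)).
apply: (@le_trans _ _ (Pr (predC (fun w => [exists p, E p w])))); last first.
  apply: prob_mono => w /=; rewrite negb_exists => /forallP h.
  by apply/forallP => i; apply/forallP => x; have := h (i, x); rewrite /E /= -leNgt.
rewrite prob_predC lerD2l lerN2; apply: le_trans (prob_exists_le _) _.
apply: (@le_trans _ _ (\sum_(p : 'I_J * T)
   4 * expR (- ((N * Ns)%:R * t ^+ 2 / (16 * F ^+ 2))))).
  by apply: ler_sum => p _; exact: deviation_le.
rewrite sumr_const card_prod card_ord -[X in X <= _]mulr_natl.
by rewrite mulrCA mulrA.
Qed.

End Sampling.

(** * Spectral decomposition of the signal and its deterministic error *)

Section Spectral.
Local Open Scope sesquilinear_scope.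
Context {R : realType} (M : nat).
Variables (v : 'I_M.+1 -> 'cV[R[i]]_M.+1) (lam : 'I_M.+1 -> R).
Variable psi : 'cV[R[i]]_M.+1.
Hypothesis v_orth : forall m m', braket (v m) (v m') = (m == m')%:R.
Hypothesis psi1 : braket psi psi = 1.

Lemma braketE (a b : 'cV[R[i]]_M.+1) :
  braket a b = \sum_i (a i 0)^*%R * b i 0.
Proof. by rewrite /braket mxE; apply: eq_bigr => i _; rewrite !mxE. Qed.

Lemma braketC (a b : 'cV[R[i]]_M.+1) : braket b a = (braket a b)^*%R.
Proof.
rewrite !braketE rmorph_sum; apply: eq_bigr => i _.
by rewrite rmorphM /= conjCK mulrC.
Qed.

(** A square matrix with orthonormal columns also has orthonormal rows. *)
Lemma resolution_of_identity : \sum_m v m *m (v m)^t* = 1%:M.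
Proof.
pose V := \matrix_(i, j) v j i 0.
have VV : V^t* *m V = 1%:M.
  apply/matrixP => i j; rewrite !mxE -v_orth braketE.
  by apply: eq_bigr => k _; rewrite !mxE.
rewrite -(mulmx1C VV); apply/matrixP => i j; rewrite summxE !mxE.
by apply: eq_bigr => k _; rewrite !mxE big_ord1 !mxE.
Qed.

Lemma braket_opfun f : braket psi (opfun v lam f *m psi) =
  \sum_m f (lam m) * (overlap v psi m)%:C.
Proof.
rewrite /braket /opfun mulmx_suml mulmx_sumr summxE.
apply: eq_bigr => m _; rewrite -scalemxAl -scalemxAr mxE; congr (_ * _).
rewrite !mulmxA -mulmxA mxE big_ord1 -/(braket _ _) -/(braket _ _).
by rewrite braketC /overlap rmorphXn /= cabs_normE normCK mulrC.
Qed.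

Lemma evol_ampE t : evol_amp v lam psi t =
  \sum_m (overlap v psi m)%:C * expi (- (t * lam m)).
Proof. by rewrite /evol_amp braket_opfun; apply: eq_bigr => m _; rewrite mulrC. Qed.

Lemma overlap_ge0 m : 0 <= overlap v psi m.
Proof. by rewrite exprn_ge0 ?cabs_ge0. Qed.

Lemma sum_overlap : \sum_m overlap v psi m = 1.
Proof.
have := braket_opfun (fun=> 1).
have -> : opfun v lam (fun=> 1) = 1%:M.
  rewrite /opfun -resolution_of_identity.
  by apply: eq_bigr => m _; rewrite scale1r.
rewrite mul1mx psi1 => /(congr1 (@complex.Re R)); rewrite Re_sum => h.
rewrite -[RHS]/(complex.Re 1) h; apply: eq_bigr => m _.
by rewrite mul1r.
Qed.

Lemma overlap_le1 m : overlap v psi m <= 1.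
Proof.
rewrite -sum_overlap (bigD1 m) //= lerDl sumr_ge0 // => k _.
exact: overlap_ge0.
Qed.

Lemma cabs_evol_amp_le1 t : cabs (evol_amp v lam psi t) <= 1.
Proof.
rewrite evol_ampE; apply: le_trans (cabs_sum _ _ _) _.
rewrite -sum_overlap; apply: ler_sum => m _.
by rewrite cabsM cabs_expi mulr1 cabs_real ger0_norm // overlap_ge0.
Qed.

(** The shifts by the frequencies of the filter sum to [trig_eval] at each eigenvalue; after
    dephasing, the term of [lam ord0] no longer depends on [n]. *)
Lemma dephased_shot_mean d (Fhat : 'I_(d.*2.+1) -> R[i]) step j n :
  shot_mean Fhat (evol_amp v lam psi) step j n *
    expi (lam ord0 * n%:R * step j) =
  \sum_m (overlap v psi m)%:C * trig_eval Fhat (lam m) *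
     expi ((lam ord0 - lam m) * n%:R * step j).
Proof.
rewrite /shot_mean mulr_suml.
under eq_bigr do rewrite evol_ampE mulr_sumr mulr_suml.
rewrite exchange_big /=; apply: eq_bigr => m _.
rewrite -[RHS]mulrA /trig_eval mulr_suml mulr_sumr; apply: eq_bigr => s _.
set e1 := expi (- _); set e2 := expi (lam _ * _ * _).
set e3 := expi (freq _ * _); set e4 := expi (_ * _ * _).
have e12 : e1 * e2 = e3 * e4 by rewrite -!expiD; congr expi; ring.
have -> : Fhat s * ((overlap v psi m)%:C * e1) * e2 =
    (overlap v psi m)%:C * (Fhat s * (e1 * e2)) by ring.
by rewrite e12 !mulrA.
Qed.

(** Each eigenvector is charged [q] times its overlap, in total [q] since overlaps sum to 1. Those
    in [P] other than the first, where the filter is merely bounded, are charged twice their overlap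
    on top. *)
Lemma signal_error_le (G w : 'I_M.+1 -> R[i]) (P : pred 'I_M.+1) q :
  0 <= q <= 1 -> P ord0 -> cabs (G ord0 - 1) <= q -> w ord0 = 1 ->
  (forall m, cabs (w m) <= 1) -> (forall m, cabs (G m) <= 1 + q) ->
  (forall m, ~~ P m -> cabs (G m) <= q) ->
  cabs (\sum_m (overlap v psi m)%:C * G m * w m - (overlap v psi ord0)%:C) <=
  q + 2 * (\sum_(m | P m) overlap v psi m - overlap v psi ord0).
Proof.
move=> /andP[q0 q1] P0 G0 w0 w1 Gb Gq.
rewrite (bigD1 ord0) //= w0 mulr1 addrAC.
have -> : (overlap v psi ord0)%:C * G ord0 - (overlap v psi ord0)%:C =
    (overlap v psi ord0)%:C * (G ord0 - 1) by rewrite mulrBr mulr1.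
apply: le_trans (cabsD _ _) _.
have h0 : cabs ((overlap v psi ord0)%:C * (G ord0 - 1)) <= q * overlap v psi ord0.
  by rewrite cabsM cabs_real ger0_norm ?overlap_ge0 // mulrC ler_wpM2r ?overlap_ge0.
have h1 : cabs (\sum_(m | m != ord0) (overlap v psi m)%:C * G m * w m) <=
    \sum_(m | m != ord0) (q * overlap v psi m +
       2 * (if P m then overlap v psi m else 0)).
  apply: le_trans (cabs_sum _ _ _) _; apply: ler_sum => m _.
  have p0 := overlap_ge0 m.
  rewrite !cabsM cabs_real (ger0_norm p0).
  apply: (@le_trans _ _ (overlap v psi m * cabs (G m))).
    by rewrite ler_piMr // mulr_ge0 // cabs_ge0.
  case: (boolP (P m)) => Pm; last first.
    by rewrite mulr0 addr0 mulrC ler_wpM2r // Gq.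
  by have := ler_wpM2l p0 (Gb m); nra.
have := sum_overlap; rewrite (bigD1 ord0) //= => sum1.
have -> : \sum_(m | P m) overlap v psi m = overlap v psi ord0 +
    \sum_(m | (m != ord0) && P m) overlap v psi m.
  rewrite (bigD1 ord0) //=; congr (_ + _).
  by apply: eq_bigl => m; rewrite andbC.
rewrite big_split /= -!mulr_sumr -big_mkcondr /= in h1.
have : q * (overlap v psi ord0 + \sum_(m < M.+1 | m != ord0) overlap v psi m) = q.
  by rewrite sum1 mulr1.
by lra.
Qed.

End Spectral.

(** With S the weight in [I'], S - p0 = S (1 - p_r), and p_r >= 1/2 gives S <= 2 p0. The bound is
    thus relative to p0, as the peak analysis requires. *)
Lemma trapped_weight_le (R : realType) (M : nat) (v : 'I_M.+1 -> 'cV[R[i]]_M.+1)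
    (lam : 'I_M.+1 -> R) (psi : 'cV[R[i]]_M.+1) (I I' : set R) :
  I `<=` I' -> I (lam ord0) -> 0 < overlap v psi ord0 ->
  1 - relative_overlap v lam psi I I' <= 1 / 2 ->
  \sum_(k | lam k \in I') overlap v psi k - overlap v psi ord0 <=
  2 * overlap v psi ord0 * (1 - relative_overlap v lam psi I I').
Proof.
move=> II' I0 p0; rewrite /relative_overlap indicE mem_set // mulr1.
set S := \sum_(k | _) _; set p := overlap v psi ord0 in p0 *.
have pS : p <= S.
  rewrite /S (bigD1 ord0) /=; last by rewrite mem_set //; exact: II'.
  by rewrite lerDl sumr_ge0 // => m _; exact: overlap_ge0.
have S0 : 0 < S by apply: lt_le_trans pS.
have -> : 1 - p / S = (S - p) / S by field; rewrite gt_eqF.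
move=> h; rewrite -[leLHS](divfK (_ : S != 0)) ?gt_eqF // mulrC.
have : S <= 2 * p by move: h; rewrite ler_pdivrMr //; lra.
by move=> S2; apply: ler_wpM2r => //; rewrite divr_ge0 ?subr_ge0 // ltW.
Qed.

(** * How many samples beat the union bound *)

Section SampleSize.
Context {R : realType}.
Implicit Types (C zeta L y P K F : R).

(** The fourth power of exp(zeta L / 4) >= (zeta / 4) (1 + L) outgrows any multiple of the cube. *)
Lemma cube_le_expR C zeta : 0 < C -> 0 < zeta <= 1 ->
  exists2 L0 : R, 0 <= L0 &
    forall L, L0 <= L -> C * (1 + L) ^+ 3 <= expR (zeta * L).
Proof.
move=> C0 /andP[z0 z1]; pose c := (zeta / 4) ^+ 4.
have z4 : 0 < zeta / 4 by rewrite divr_gt0.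
have c0 : 0 < c by exact: exprn_gt0.
exists (C / c); first by rewrite divr_ge0 // ltW.
move=> L hL; have L0 : 0 <= L by apply: le_trans hL; rewrite divr_ge0 // ltW.
have L1 : 0 < 1 + L by lra.
have -> : expR (zeta * L) = expR (zeta / 4 * L) ^+ 4.
  by rewrite -expRM_natl; congr expR; field.
apply: (@le_trans _ _ ((zeta / 4 * (1 + L)) ^+ 4)); last first.
  rewrite ler_pXn2r // ?nnegrE ?expR_ge0 //; first last.
    by rewrite mulr_ge0 // ltW.
  by apply: le_trans (expR_ge1Dx _); nra.
rewrite exprMn -/c [X in _ <= _ * X]exprS [leRHS]mulrA ler_pM2r ?exprn_gt0 //.
by move: hL; rewrite ler_pdivrMr // mulrC; nra.
Qed.

Lemma ln_le_sub1 (x : R) : 0 < x -> ln x <= x - 1.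
Proof.
by move=> x0; have := @le_ln1Dx R (x - 1); rewrite [1 + _]addrC subrK; apply; lra.
Qed.

(* The logarithms of [delta] hidden in [F] and in [K] are absorbed by the spare
   factor [delta ^- zeta = expR (zeta * L)], here [L = - ln delta]. *)
Lemma sample_size_suffices (ka cF zeta : R) : 1 <= ka -> 1 <= cF ->
  0 < zeta <= 1 ->
  exists2 L0 : R, 0 <= L0 & forall L y P K F, L0 <= L -> 0 <= y <= P ->
    2 <= P -> 0 < F <= cF * (P * (1 + L)) ->
    expR (2 * y + (2 + zeta) * L) * P ^+ 3 <= K ->
    ka * expR (3 * P) * K * F <=
      expR (K * expR (- (2 * y + 2 * L)) / (ka * F ^+ 2)).
Proof.
move=> ka1 cF1 z01; pose c1 := ka + 3 + cF.
(* The cube of 1 + L stems from F^2 and one logarithm of the union bound; the same three factors use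
   up P^3, whence the polylog exponent 3. *)
pose C := 2 * (8 + c1) * (ka * cF ^+ 2).
have kc0 : 0 < ka * cF ^+ 2 by rewrite mulr_gt0 ?exprn_gt0 //; lra.
have C0 : 0 < C by rewrite /C mulr_gt0 // /c1; lra.
have [L0 L00 hL0] := cube_le_expR C0 z01.
(* In the application y = - ln p0, P is the base of the polylog, K = N Ns and F is the coefficient
   norm. *)
exists L0 => // L y P K F hL /andP[y0 yP] P2 /andP[F0 FQ] hK.
have L_ge0 : 0 <= L by lra.
have hexp := hL0 _ hL; have /andP[z0 z1] := z01.
set E := expR (zeta * L) in hexp.
set U := expR (2 * y + 2 * L).
have U0 : 0 < U by exact: expR_gt0.
have E0 : 0 < E by exact: expR_gt0.
have P30 : 0 < P ^+ 3 by rewrite exprn_gt0 //; lra.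
have KE : expR (2 * y + (2 + zeta) * L) = U * E.
  by rewrite -expRD; congr expR; ring.
rewrite KE in hK; set K0 := U * E * P ^+ 3 in hK.
have K00 : 0 < K0 by rewrite /K0 mulr_gt0 // mulr_gt0.
have Kp : 0 < K by apply: lt_le_trans hK.
set Q := P * (1 + L) in FQ.
have Q2 : 2 <= Q by rewrite /Q; nra.
have PQ : P <= Q by rewrite /Q; nra.
have LQ : L <= Q by rewrite /Q; nra.
have lnK0 : ln K0 <= 8 * Q.
  have Pp : 0 < P by lra.
  have -> : K0 = expR (2 * y + (2 + zeta) * L + 3 * ln P).
    by rewrite expRD KE expRM_natl lnK ?posrE.
  rewrite expRK.
  have : ln P <= P - 1 by apply: ln_le_sub1; lra.
  have : zeta * L <= L by rewrite ler_piMl.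
  by lra.
(* [K] may lie far above its lower bound [K0], so the excess ln(K / K0) is charged to K / K0 instead
   of [Q]. *)
have lnK_le : ln K <= K / K0 + 8 * Q.
  have -> : K = K / K0 * K0 by rewrite divfK // gt_eqF.
  rewrite lnM ?posrE ?divr_gt0 //; apply: lerD => //.
  have : 0 < K / K0 by rewrite divr_gt0.
  by rewrite divfK ?gt_eqF // => /ln_le_sub1; lra.
(* An upper bound for the denominator ka F^2 U of the exponent. In [main], half of K pays for A K /
   K0 and the other half for A (8 + c1) Q. *)
pose A := ka * cF ^+ 2 * Q ^+ 2 * U.
have A0 : 0 < A by rewrite /A mulr_gt0 // mulr_gt0 // exprn_gt0 //; lra.
have AQ : 2 * (8 + c1) * (A * Q) <= K0.
  have -> : 2 * (8 + c1) * (A * Q) = (U * P ^+ 3) * (C * (1 + L) ^+ 3).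
    by rewrite /A /C /Q; ring.
  have -> : K0 = (U * P ^+ 3) * E by rewrite /K0; ring.
  by rewrite ler_pM2l // mulr_gt0.
have AK : 2 * A <= K0.
  apply: le_trans AQ; rewrite /c1.
  have : A <= A * Q by rewrite ler_peMr //; lra.
  have : 0 < A * Q by rewrite mulr_gt0 //; lra.
  by rewrite /c1; nra.
have main : A * (ln K + c1 * Q) <= K.
  apply: (@le_trans _ _ (A * (K / K0 + 8 * Q + c1 * Q))).
    by rewrite ler_pM2l //; lra.
  have : A * (K / K0) <= K / 2.
    rewrite mulrA ler_pdivrMr // -subr_ge0.
    have -> : K / 2 * K0 - A * K = K / 2 * (K0 - 2 * A) by field.
    by rewrite mulr_ge0 ?subr_ge0 // divr_ge0 // ltW.
  have : 2 * (8 + c1) * (A * Q) <= K by apply: le_trans hK.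
  by lra.
have -> : K * expR (- (2 * y + 2 * L)) / (ka * F ^+ 2) = K / (ka * F ^+ 2 * U).
  by rewrite expRN -/U; field; rewrite (gt_eqF U0) (gt_eqF F0) gt_eqF //; lra.
apply: (@le_trans _ _ (expR (ln K + c1 * Q))); last first.
  rewrite ler_expR; apply: (@le_trans _ _ (K / A)).
    by rewrite ler_pdivlMr // mulrC.
  have kFU0 : 0 < ka * F ^+ 2 * U.
    by rewrite mulr_gt0 // mulr_gt0 ?exprn_gt0 //; lra.
  rewrite ler_pM2l // lef_pV2 ?posrE //.
  rewrite /A ler_pM2r // -mulrA ler_pM2l; last lra.
  by rewrite -exprMn ler_pXn2r ?nnegrE //; [lra|apply: mulr_ge0; lra].
rewrite expRD lnK ?posrE //.
have -> : ka * expR (3 * P) * K * F = K * (ka * expR (3 * P) * F) by ring.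
rewrite ler_pM2l //.
apply: (@le_trans _ _ (expR ka * expR (3 * P) * expR F)).
  have h (x : R) : 0 <= x -> x <= expR x.
    by move=> x0; apply: le_trans (expR_ge1Dx _); lra.
  apply: ler_pM; rewrite ?mulr_ge0 ?expR_ge0 ?h //; try lra.
  by rewrite ler_pM2r ?expR_gt0 // h //; lra.
rewrite -!expRD ler_expR /c1.
have : ka <= ka * Q by rewrite ler_peMr //; lra.
by lra.
Qed.

End SampleSize.

(** * The schedule of time steps and the evolution times *)

Section ScheduleFacts.
Context {R : realType} (delta eps : R) (N : nat).
Hypotheses (eps_in : 0 < eps < 1 / 2) (delta_gt0 : 0 < delta) (N_gt0 : (0 < N)%N).
Local Notation c := (absz (log2_ceil eps)).
Local Notation tau := (tau delta eps N).
Local Notation J := (levels eps).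

Let eps_gt0 : 0 < eps. Proof. by case/andP: eps_in. Qed.
Let N_gt0' : 0 < N%:R :> R. Proof. by rewrite ltr0n. Qed.
Let ln2_gt0 : 0 < ln 2 :> R. Proof. by apply: ln_gt0; lra. Qed.

Lemma ln2_ge_half : 1 / 2 <= ln 2 :> R.
Proof.
have := @le_ln1Dx R (- (1 / 2)).
have -> : 1 + - (1 / 2) = 2^-1 :> R by field.
by rewrite lnV ?posrE //; lra.
Qed.

Let lnV_eps_gt : ln 2 < ln eps^-1.
Proof.
rewrite ltr_ln ?posrE ?invr_gt0 // -[ltLHS]invrK ltf_pV2 ?posrE //.
by case/andP: eps_in; rewrite div1r.
Qed.

(** As eps < 1/2 the ceiling is nonnegative, so [absz] in [levels] changes nothing. *)
Lemma log2_ceilE : log2_ceil eps = c%:Z.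
Proof.
rewrite gez0_abs // /log2_ceil ceil_ge0.
apply: (@lt_le_trans _ _ 0); first by lra.
by apply: divr_ge0; apply: ltW => //; exact: lt_trans lnV_eps_gt.
Qed.

Lemma levels_gt1 : (1 < J)%N.
Proof.
rewrite ltnS -(ltr_nat R); have -> : c%:R = (log2_ceil eps)%:~R :> R.
  by rewrite [in RHS]log2_ceilE.
apply: lt_le_trans (ceil_ge _); rewrite divr_gt0 //.
exact: lt_trans lnV_eps_gt.
Qed.

(** Linear in ln(1/eps), so that the union bound over levels costs only a log log, which the polylog
    contains. The additive terms are absorbed since ln(1/eps) > 1/2. *)
Lemma levels_le : J%:R <= 6 * ln eps^-1.
Proof.
have h : c%:R < ln eps^-1 / ln 2 + 1 :> R.
  have -> : c%:R = (log2_ceil eps)%:~R :> R by rewrite [in RHS]log2_ceilE.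
  have := ceilB1_lt (ln eps^-1 / ln 2); rewrite rmorphB /= /log2_ceil.
  by lra.
have : ln eps^-1 / ln 2 <= 2 * ln eps^-1.
  rewrite ler_pdivrMr //; have := ln2_ge_half; have := lt_trans ln2_gt0 lnV_eps_gt.
  by nra.
move=> h'; rewrite /levels -[leLHS]natr1.
by have h2 := ln2_ge_half; move: lnV_eps_gt; lra.
Qed.

Lemma tau_gt0 j : 0 < tau j.
Proof. by rewrite mulr_gt0 ?exprz_gt0 // divr_gt0 ?mulr_gt0. Qed.

Lemma tauS j : tau j.+1 = 2 * tau j.
Proof.
rewrite /Defs.tau (_ : j.+1%:Z - 1 - _ = 1 + (j%:Z - 1 - log2_ceil eps)).
  by rewrite expfzDr ?pnatr_eq0 // expr1z -mulrA.
by rewrite intS; ring.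
Qed.

Lemma tau_levels : tau J = delta / (N%:R * eps).
Proof.
by rewrite /Defs.tau /levels log2_ceilE intS [1 + _]addrC addrK subrr expr0z mul1r.
Qed.

Lemma tau_levels_eps : eps = delta / (N%:R * tau J).
Proof. by rewrite tau_levels; field; rewrite !gt_eqF. Qed.

(** Rounding log2(1/eps) upwards makes the first step at most eps times the last one. *)
Lemma tau1_le : N%:R * tau 1 <= delta.
Proof.
have h : eps^-1 <= 2 ^+ c.
  rewrite -(lnK (_ : eps^-1 \is Num.pos)) ?posrE ?invr_gt0 //.
  rewrite -[2 in leRHS](lnK (_ : 2 \is Num.pos)) ?posrE //.
  rewrite -expRM_natl ler_expR -ler_pdivrMr //.
  have -> : c%:R = (log2_ceil eps)%:~R :> R by rewrite [in RHS]log2_ceilE.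
  exact: ceil_ge.
rewrite /Defs.tau [in _ - log2_ceil _]log2_ceilE subrr sub0r -exprnN.
have X0 : 0 < 2 ^+ c :> R by exact: exprn_gt0.
move: (2 ^+ c) X0 h => X X0 h.
have -> : N%:R * (X^-1 * (delta / (N%:R * eps))) = delta * (eps^-1 / X).
  by field; rewrite (gt_eqF X0) (gt_eqF eps_gt0) (gt_eqF N_gt0').
by rewrite ger_pMr // ler_pdivrMr // mul1r.
Qed.

Lemma le_tau : {homo tau : i j / (i <= j)%N >-> i <= j}.
Proof.
apply: homo_leq => // [|j]; first exact: le_trans.
by rewrite tauS ler_peMl ?ltW ?tau_gt0 //; lra.
Qed.

Lemma sum_tau m : \sum_(i < m) tau i.+1 = tau m.+1 - tau 1.
Proof.
elim: m => [|m IH]; first by rewrite big_ord0 subrr.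
by rewrite big_ord_recr /= IH (tauS m.+1); ring.
Qed.

Lemma T_maxE d : T_max d J N tau = d%:R + delta / eps.
Proof.
have -> : delta / eps = N%:R * tau J.
  by rewrite tau_levels; field; rewrite !gt_eqF.
rewrite /T_max; apply/eqP; rewrite eq_le; apply/andP; split.
  apply: bigmax_le => [|i _].
    by rewrite addr_ge0 // mulr_ge0 // ltW // tau_gt0.
  by rewrite lerD2l ler_wpM2l // le_tau.
exact: (le_bigmax _ (fun i : 'I_J => d%:R + N%:R * tau i.+1) ord_max).
Qed.

(** The steps form a geometric progression of ratio 2, whose sum is 2 tau_J - tau_1. *)
Lemma T_totalE d Ns : T_total d J Ns N tau =
  (N * Ns)%:R * (2 * J%:R * d%:R + (N%:R - 1) * (2 * tau J - tau 1)).
Proof.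
have sn : \sum_(n < N) (n%:R : R) = N%:R * (N%:R - 1) / 2.
  elim: N => [|m IH]; first by rewrite big_ord0 !mul0r.
  by rewrite big_ord_recr /= IH -[m.+1%:R]natr1; field.
rewrite -tauS -sum_tau mulr_sumr.
rewrite (_ : 2 * J%:R * d%:R = \sum_(i < J) 2 * d%:R); last first.
  by rewrite sumr_const card_ord -[RHS]mulr_natl; ring.
rewrite -big_split /= mulr_sumr; apply: eq_bigr => i _.
rewrite sumr_const card_ord -mulr_sumr big_split /= -mulr_suml sn.
by rewrite sumr_const card_ord natrM -(mulr_natl d%:R N) -[LHS]mulr_natl; field.
Qed.

(** Geometric growth makes the last level dominate the terms in tau, whereas [d] is paid at each
    level, hence the factor [J] in the upper bound. For N >= 2, N - 1 >= N / 2. *)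
Lemma T_total_bounds d Ns : (1 < N)%N ->
  (N * Ns)%:R / 2 * (d%:R + delta / eps) <= T_total d J Ns N tau <=
  2 * (N * Ns)%:R * (J%:R * d%:R + delta / eps).
Proof.
move=> N2; have N2' : 2 <= N%:R :> R by rewrite ler_nat.
have -> : delta / eps = N%:R * tau J.
  by rewrite tau_levels; field; rewrite !gt_eqF.
have J1 : 1 <= J%:R :> R by rewrite ler1n.
have d0 : 0 <= d%:R :> R by [].
have dJ : d%:R <= J%:R * d%:R :> R by rewrite ler_peMl.
have t1 := tau_gt0 1; have t1J : tau 1 <= tau J by exact: le_tau.
rewrite T_totalE.
have h1 : (d%:R + N%:R * tau J) / 2 <=
    2 * J%:R * d%:R + (N%:R - 1) * (2 * tau J - tau 1).
  have : N%:R / 2 * tau J <= (N%:R - 1) * (2 * tau J - tau 1).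
    by apply: ler_pM; lra.
  by lra.
have h2 : 2 * J%:R * d%:R + (N%:R - 1) * (2 * tau J - tau 1) <=
    2 * (J%:R * d%:R + N%:R * tau J).
  have : (N%:R - 1) * (2 * tau J - tau 1) <= N%:R * (2 * tau J).
    by apply: ler_pM; lra.
  by lra.
have K0 : 0 <= (N * Ns)%:R :> R by [].
apply/andP; split.
  have -> : (N * Ns)%:R / 2 * (d%:R + N%:R * tau J) =
      (N * Ns)%:R * ((d%:R + N%:R * tau J) / 2) by ring.
  exact: ler_wpM2l.
have -> : 2 * (N * Ns)%:R * (J%:R * d%:R + N%:R * tau J) =
    (N * Ns)%:R * (2 * (J%:R * d%:R + N%:R * tau J)) by ring.
exact: ler_wpM2l.
Qed.

End ScheduleFacts.

(** * The estimate at one level and the induction over levels *)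

Section Level.
Context {R : realType} (N : nat).
Implicit Types (x lam t s B p delta F : R) (e Z : 'I_N -> R[i]).

Lemma weighted_mean_sub u Z Z' : weighted_mean u Z - weighted_mean u Z' =
  weighted_mean u (fun n : 'I_N => Z n - Z' n).
Proof.
rewrite /weighted_mean -mulrBr -sumrB; congr (_ * _).
by apply: eq_bigr => n _; rewrite mulrBl.
Qed.

Lemma weighted_mean_dephased u lam t Z :
  weighted_mean u (dephased lam t Z) =
  weighted_mean (fun n => u n * expi (lam * n%:R * t)) Z.
Proof.
congr (_ * _); apply: eq_bigr => n _.
by rewrite /dephased -mulrA [expi _ * _]mulrC.
Qed.

(** Equally spaced points from -4 to 4, the range of the offsets to be controlled. *)
Definition grid_point (G g : nat) : R := 8 / G%:R * g%:R - 4.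

Lemma grid_near G x : (0 < G)%N -> `|x| <= 4 ->
  exists g : 'I_G.+1, `|x - grid_point G g| <= 8 / G%:R.
Proof.
move=> G0; rewrite ler_norml => /andP[x1 x2].
have G0' : 0 < G%:R :> R by rewrite ltr0n.
pose y := (x + 4) / 8 * G%:R.
have y0 : 0 <= y by rewrite mulr_ge0 // divr_ge0; lra.
have yG : y <= G%:R by rewrite ger_pMl // ler_pdivrMr //; lra.
have /andP[g1 g2] := truncn_itv y0.
have gG : (Num.truncn y < G.+1)%N.
  by rewrite ltnS -(ler_nat R); apply: le_trans yG.
exists (Ordinal gG); rewrite /grid_point /=.
have -> : x - (8 / G%:R * (Num.truncn y)%:R - 4) =
    8 / G%:R * (y - (Num.truncn y)%:R).
  by rewrite /y; field; rewrite gt_eqF.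
rewrite -natr1 in g2; have G8 : 0 <= 8 / G%:R :> R by rewrite divr_ge0 // ltW.
rewrite normrM ger0_norm // -[leRHS]mulr1 ler_wpM2l // ger0_norm; lra.
Qed.

(** Between grid points the Lipschitz bound takes over, for which the crude pointwise bound [B] is
    enough when [G] is large. *)
Lemma fourier_mean_grid G e s B x : (0 < N)%N -> (0 < G)%N ->
  (forall n, cabs (e n) <= B) ->
  (forall g : 'I_G.+1, cabs (fourier_mean e (grid_point G g)) <= s) ->
  `|x| <= 4 -> cabs (fourier_mean e x) <= s + 8 * N%:R * B / G%:R.
Proof.
move=> N0 G0 eB hs x4; have [g hg] := grid_near G0 x4.
have -> : fourier_mean e x = fourier_mean e (grid_point G g) +
    (fourier_mean e x - fourier_mean e (grid_point G g)) by rewrite addrC subrK.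
apply: le_trans (cabsD _ _) (lerD (hs g) _).
apply: le_trans (fourier_mean_lipschitz x (grid_point G g) N0 eB) _.
have B0 : 0 <= B by apply: le_trans (eB (Ordinal N0)); exact: cabs_ge0.
have -> : 8 * N%:R * B / G%:R = N%:R * (8 / G%:R) * B by ring.
by rewrite ler_wpM2r // ler_wpM2l.
Qed.

(** [e1] is small pointwise; the noise [e2] is not, but its tails and its Fourier means on the grid
    are. Both feed [peak_stability] with error 2 ga, and 4320 = 2 * 2160. *)
Lemma level_estimate (p ga F : R) (G : nat) (e1 e2 : 'I_N -> R[i]) x :
  (1 < N)%N -> (0 < G)%N -> 0 < p -> 0 < ga -> 36 * ga <= p ->
  432 * (N%:R * F / p) <= G%:R ->
  (forall n, cabs (e1 n) <= ga) ->
  (forall n, cabs (e2 n) <= 3 * F) ->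
  (forall g : 'I_G.+1, cabs (fourier_mean e2 (grid_point G g)) <= ga) ->
  (forall m : 'I_N,
    cabs (weighted_mean (fun n => (m <= n)%N%:R) e2) <= ga) ->
  `|x| <= 4 ->
  cabs (fourier_mean (fun n => p%:C + (e1 n + e2 n)) 0) <=
    cabs (fourier_mean (fun n => p%:C + (e1 n + e2 n)) x) ->
  N%:R * `|x| * p <= 4320 * ga.
Proof.
move=> N1 G0 p0 ga0 gap hG he1 he2 hgrid htail x4 hmax.
have N0 : (0 < N)%N by rewrite ltnW.
have G0' : 0 < G%:R :> R by rewrite ltr0n.
have hx1 : cabs (fourier_mean (fun n => e1 n + e2 n) x) <= p / 9.
  rewrite fourier_meanD; apply: le_trans (cabsD _ _) _.
  have h1 := fourier_mean_le x N0 he1.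
  have h2 := fourier_mean_grid N0 G0 he2 hgrid x4.
  (* 432 = 24 * 18: interpolation takes p / 18, and 2 ga takes the other p / 18. *)
  have h3 : 8 * N%:R * (3 * F) / G%:R <= p / 18.
    rewrite ler_pdivrMr //.
    have p18 : 0 <= p / 18 by lra.
    have := ler_wpM2l p18 hG.
    have -> : p / 18 * (432 * (N%:R * F / p)) = 8 * N%:R * (3 * F).
      by field; rewrite gt_eqF.
    by [].
  move: (cabs _) (cabs _) (8 * _ * _ / _) h1 h2 h3 => c1 c2 b h1 h2 h3.
  by clear -h1 h2 h3 gap; lra.
have hx0 : cabs (fourier_mean (fun n => e1 n + e2 n) 0) <= 2 * ga.
  rewrite fourier_meanD; apply: le_trans (cabsD _ _) _.
  have h1 := fourier_mean_le 0 N0 he1.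
  have h2 := htail (Ordinal N0).
  have e20 : fourier_mean e2 0 = weighted_mean (fun n => (0 <= n)%N%:R) e2.
    by congr (_ * _); apply: eq_bigr => n _; rewrite mulr0 expi0.
  by rewrite mulr_natl mulr2n e20; exact: lerD.
have hxx : cabs (fourier_mean (fun n => e1 n + e2 n) x -
    fourier_mean (fun n => e1 n + e2 n) 0) <= N%:R * `|x| * (2 * ga).
  rewrite !fourier_meanD opprD addrACA; apply: le_trans (cabsD _ _) _.
  have h1 := fourier_mean_lipschitz x 0 N0 he1; rewrite subr0 in h1.
  have h2 := fourier_mean_abel x N0 (ltW ga0) htail.
  by rewrite [2 * ga]mulr_natl mulr2n mulrDr; exact: lerD.
have ga2 : 2 * ga <= p / 9 by clear -gap ga0; lra.
have := peak_stability N1 p0 x4 hx1 hx0 ga2 hxx hmax.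
by clear; lra.
Qed.

End Level.

(** Invariant: N |theta - lam| step <= 2 pi delta. At the first level it follows from N tau_1 <=
    delta and the initial interval; afterwards [hlev] gives the sharper [delta], and J > 1 ensures
    that the output has it. *)
Lemma qcels_error (R : realType) (N J : nat) (step theta : nat -> R)
    (Z : 'I_J -> 'I_N -> R[i]) (r : nat -> R[i]) (lam delta : R) :
  (1 < N)%N -> (1 < J)%N -> (forall j, 0 < step j) ->
  (forall j, step j.+1 = 2 * step j) -> N%:R * step 1 <= delta ->
  0 < delta <= 1 / 2 -> pi + 2 * pi * delta <= 4 -> - pi <= lam <= pi ->
  (forall (i : 'I_J) (lo hi th : R) (z : R[i]),
    loss_argmin (Z i) (step i.+1) lo hi z th -> lo <= lam <= hi ->
    `|(th - lam) * step i.+1| <= 4 -> N%:R * `|(th - lam) * step i.+1| < delta) ->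
  qcels_run step theta Z r ->
  N%:R * `|(theta J - lam) * step J| < delta.
Proof.
move=> N1 J1 step0 stepS step1 /andP[d0 d2] dpi /andP[lam1 lam2] hlev hrun.
have N2 : 2 <= N%:R :> R by rewrite ler_nat.
have p0 : 0 < pi :> R by exact: pi_gt0.
have key i : (i < J)%N ->
    N%:R * `|(theta i.+1 - lam) * step i.+1| <= 2 * pi * delta /\
    ((0 < i)%N -> N%:R * `|(theta i.+1 - lam) * step i.+1| < delta).
  elim: i => [|i IH] iJ.
    split=> //; have [/andP[t1 t2] _] := hrun (Ordinal iJ).
    rewrite /lambda_min /lambda_max /= in t1 t2.
    have h : `|theta 1 - lam| <= 2 * pi by rewrite ler_norml; lra.
    rewrite normrM (gtr0_norm (step0 1)) mulrCA.
    by apply: ler_pM => //; rewrite mulr_ge0 // ltW.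
  have [IH1 _] := IH (ltnW iJ).
  have [/andP[t1 t2] _] := hrun (Ordinal iJ).
  rewrite /lambda_min /lambda_max /= in t1 t2.
  have s0 := step0 i.+1; set s := step i.+1 in s0 t1 t2 IH1.
  set a := (theta i.+1 - lam) * s in IH1.
  have pd : pi * delta <= pi * (1 / 2) by rewrite ler_pM2l.
  (* N >= 2 halves the invariant; with delta <= 1/2 the offset is at most pi / 2, so [lam] lies in
     the next search interval. *)
  have ha : `|a| <= pi * delta.
    have := normr_ge0 a; move: IH1; nra.
  have ha' := ha; rewrite ler_norml in ha'; have /andP[a1 a2] := ha'.
  have hE b : b / (2 * s) * s = b / 2 by field; rewrite gt_eqF.
  have l1 : theta i.+1 - pi / (2 * s) <= lam.
    rewrite -(ler_pM2r s0) mulrBl hE; move: a2; rewrite /a mulrBl; lra.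
  have l2 : lam <= theta i.+1 + pi / (2 * s).
    rewrite -(ler_pM2r s0) mulrDl hE; move: a1; rewrite /a mulrBl; lra.
  (* Doubling the step doubles the old offset to at most 2 pi delta, and the half-width of the
     interval adds pi. *)
  have hx : `|(theta i.+2 - lam) * step i.+2| <= 4.
    have t1' : theta i.+1 * s - pi / 2 <= theta i.+2 * s.
      by rewrite -hE -mulrBl ler_pM2r.
    have t2' : theta i.+2 * s <= theta i.+1 * s + pi / 2.
      by rewrite -hE -mulrDl ler_pM2r.
    rewrite stepS -/s ler_norml; move: a1 a2; rewrite /a mulrBl => a1 a2.
    have -> : (theta i.+2 - lam) * (2 * s) = 2 * (theta i.+2 * s - lam * s).
      by ring.
    by apply/andP; split; lra.
  have h := hlev (Ordinal iJ) _ _ _ _ (hrun (Ordinal iJ)).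
  rewrite /lambda_min /lambda_max /= -/s in h.
  have h2 := h (introT andP (conj l1 l2)) hx.
  split=> //; apply: le_trans (ltW h2) _.
  by have := @pi_ge2 R; nra.
have JE : J = J.-1.+1 by rewrite prednK // ltnW.
by rewrite JE; apply: (key J.-1 _).2; lia.
Qed.

Lemma symmod_small (R : realType) (y : R) : `|y| < 1 / 2 -> symmod pi y = y.
Proof.
rewrite ltr_norml => /andP[y1 y2]; rewrite /symmod.
have p2 := @pi_ge2 R.
rewrite (@floor_def _ _ 0) ?mulr0 ?subr0 //.
by rewrite add0r ler_pdivlMr ?ltr_pdivrMr; lra.
Qed.

(** * The failure probability in terms of the sample-size hypothesis *)

Section FailureBound.
Context {R : realType}.

Lemma ln_polylog_le (kd : R) (p0 delta : R) : 0 <= kd -> 0 < p0 <= 1 ->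
  0 < delta <= 1 ->
  ln (polylog kd [:: p0^-1; delta^-1]) <= kd * (1 - ln p0 - ln delta).
Proof.
move=> kd0 /andP[p00 p01] /andP[d0 d1].
have lp := ln_le0 p01; have ld := ln_le0 d1.
rewrite /polylog ln_powR ler_wpM2l // !big_cons big_nil !lnV ?posrE //.
rewrite !normrN !ler0_norm //.
have h : 0 < 2 + (- ln p0 + (- ln delta + 0)) by lra.
by have := ln_le_sub1 h; lra.
Qed.

(** Puts the sample-size hypothesis into the exponential form of [sample_size_suffices]. *)
Lemma product_boundE (zeta p0 delta eps D eta : R) : 0 < p0 -> 0 < delta ->
  product_bound 3 p0 delta zeta eps D eta =
  expR (2 * (- ln p0) + (2 + zeta) * (- ln delta)) *
  (2 + \sum_(x <- [:: ln zeta^-1; ln eps^-1; D^-1; eta^-1; p0^-1]) `|ln x|) ^+ 3.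
Proof.
move=> p00 d0; rewrite /product_bound /polylog powR_mulrn; last first.
  by rewrite addr_ge0 // sumr_ge0.
congr (_ * _); rewrite expRD; congr (_ * _).
  by rewrite expRM_natl expRN lnK ?posrE // exprVn.
by rewrite /powR gt_eqF //; congr expR; ring.
Qed.

Lemma le_expR_norm_ln (x P : R) : `|ln x| <= P -> x <= expR P.
Proof.
move=> h; have [x0|x0] := leP x 0; first exact: le_trans x0 (expR_ge0 _).
rewrite -[leLHS](lnK (_ : _ \is Num.pos)) ?posrE // ler_expR.
exact: le_trans (ler_norm _) h.
Qed.

(** Controls F = O(log d): ln(1/D) is part of P, and the logarithm of a polylog is at most linear in
    - ln p0 and - ln delta. *)
Lemma ln_degree_le (cd' kd p0 delta D P : R) (d : nat) :
  0 < cd' -> 0 <= kd -> 0 < p0 <= 1 -> 0 < delta <= 1 -> 0 < D ->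
  1 + - ln p0 <= P -> `|ln D^-1| <= P -> (0 < d)%N ->
  d%:R <= cd' * (D^-1 * polylog kd [:: p0^-1; delta^-1]) ->
  ln d%:R <= (`|ln cd'| + 1 + kd) * (P * (1 + - ln delta)).
Proof.
move=> cd0 kd0 p01 d01 D0 yP DP d0 hd.
have pl0 : 0 < polylog kd [:: p0^-1; delta^-1].
  rewrite /polylog powR_gt0 //; apply: (@lt_le_trans _ _ 2) => //.
  by rewrite lerDl sumr_ge0.
have lnd1 : ln d%:R <= ln cd' + (ln D^-1 + kd * (1 - ln p0 - ln delta)).
  apply: (@le_trans _ _ (ln (cd' * (D^-1 * polylog kd [:: p0^-1; delta^-1])))).
    by rewrite ler_ln ?posrE ?ltr0n // !mulr_gt0 // invr_gt0.
  rewrite lnM ?posrE ?mulr_gt0 ?invr_gt0 // lerD2l.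
  by rewrite lnM ?posrE ?invr_gt0 // lerD2l ln_polylog_le.
apply: le_trans lnd1 _.
have L0 : 0 <= - ln delta by rewrite oppr_ge0 ln_le0 //; case/andP: d01.
have y0 : 0 <= - ln p0 by rewrite oppr_ge0 ln_le0 //; case/andP: p01.
move: (- ln p0) (- ln delta) yP y0 L0 => y L yP y0 L0.
have PQ : P <= P * (1 + L) by rewrite ler_peMr //; lra.
have c3 : 1 + y + L <= P * (1 + L).
  have : L <= P * L by rewrite ler_peMl //; lra.
  by lra.
have c1 : ln cd' <= `|ln cd'| * (P * (1 + L)).
  by apply: le_trans (ler_norm _) _; rewrite ler_peMr //; lra.
have c2 : ln D^-1 <= P * (1 + L).
  exact: le_trans (le_trans (ler_norm _) DP) PQ.
have c4 := ler_wpM2l kd0 c3.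
rewrite !mulrDl mul1r -[leRHS]addrA; apply: lerD => //; exact: lerD.
Qed.

(** The number of levels, 1/p0 and 1/eta are each at most a constant times exp P, which gives the
    factor exp(3 P) of [sample_size_suffices]. The threshold [delta0] depends only on zeta and the
    constants. *)
Lemma failure_bound (tc cd' kd b' zeta : R) : 26 <= tc -> 0 < cd' -> 0 <= kd ->
  0 < b' -> 0 < zeta <= 1 ->
  exists2 delta0 : R, 0 < delta0 <= 1 &
  forall (p0 delta eps D eta F : R) (d N Ns G : nat),
  0 < p0 <= 1 -> 0 < delta <= delta0 -> 0 < eps < 1 / 2 -> 0 < D ->
  0 < eta < 1 -> 1 / 2 <= F <= b' * ln d%:R ->
  d%:R <= cd' * (D^-1 * polylog kd [:: p0^-1; delta^-1]) ->
  (1 < N)%N -> (0 < Ns)%N ->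
  product_bound 3 p0 delta zeta eps D eta <= (N * Ns)%:R ->
  G%:R <= 432 * (N%:R * F / p0) + 1 ->
  4 * (levels eps * (G.+1 + N))%:R *
    expR (- ((N * Ns)%:R * (p0 * delta / tc) ^+ 2 / (16 * F ^+ 2))) <= eta.
Proof.
move=> tc26 cd0 kd0 b0 z01.
(* [16 * tc ^+ 2] comes from the Chernoff exponent at deviation p0 delta / tc; for tc >= 26 it also
   exceeds the prefactor 4 * 6 * 440 met below. *)
have [ka kaE ka1] : exists2 ka : R, ka = 16 * tc ^+ 2 & 1 <= ka.
  by exists (16 * tc ^+ 2) => //; nra.
have tc0 : tc != 0 by rewrite gt_eqF //; lra.
have c0 : 0 <= `|ln cd'| + 1 + kd by rewrite !addr_ge0.
have cF1 : 1 <= b' * (`|ln cd'| + 1 + kd) + 1.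
  by rewrite lerDr mulr_ge0 // ltW.
have [L0 L00 hL0] := sample_size_suffices ka1 cF1 z01.
exists (expR (- L0)); first by rewrite expR_gt0 expR_le1 oppr_le0.
move=> p0 delta eps D eta F d N Ns G p01 /andP[d0 dd0] he D0.
move=> /andP[eta0 eta1] /andP[F1 Fd] hd N1 Ns0 hK hG.
have [p00 p0_le1] := andP p01.
have d1 : delta <= 1 by apply: le_trans dd0 _; rewrite expR_le1 oppr_le0.
have d01 : 0 < delta <= 1 by rewrite d0.
have y0 : 0 <= - ln p0 by rewrite oppr_ge0 ln_le0.
have L0L : L0 <= - ln delta.
  by rewrite lerNr -[- L0]expRK ler_ln // posrE expR_gt0.
have F0 : 0 < F by apply: lt_le_trans F1; exact: divr_gt0.
(* [ln 0] is 0 by convention, so [d = 0] would contradict [F >= 1/2]. *)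
have d_gt0 : (0 < d)%N.
  rewrite lt0n; apply/negP => /eqP de; have := le_trans F1 Fd.
  by rewrite de ln0 // mulr0 leNgt divr_gt0.
rewrite product_boundE // in hK.
set P := 2 + \sum_(x <- _) _ in hK.
have [P2 yP] : 2 <= P /\ 1 + - ln p0 <= P.
  have lp : `|ln p0^-1| = - ln p0 by rewrite lnV ?posrE // ger0_norm.
  rewrite /P !big_cons big_nil lp.
  have := normr_ge0 (ln (ln zeta^-1)); have := normr_ge0 (ln (ln eps^-1)).
  have := normr_ge0 (ln D^-1); have := normr_ge0 (ln eta^-1).
  by clear -y0; split; lra.
have [epsP DP etaP p0P] : [/\ `|ln (ln eps^-1)| <= P, `|ln D^-1| <= P,
    `|ln eta^-1| <= P & `|ln p0^-1| <= P].
  rewrite /P !big_cons big_nil.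
  have := normr_ge0 (ln (ln zeta^-1)); have := normr_ge0 (ln (ln eps^-1)).
  have := normr_ge0 (ln D^-1); have := normr_ge0 (ln eta^-1).
  have := normr_ge0 (ln p0^-1).
  by clear; split; lra.
clearbody P.
have lnd := ln_degree_le cd0 kd0 p01 d01 D0 yP DP d_gt0 hd.
have FQ : F <= (b' * (`|ln cd'| + 1 + kd) + 1) * (P * (1 + - ln delta)).
  apply: le_trans Fd _; apply: le_trans (ler_wpM2l (ltW b0) lnd) _.
  rewrite mulrA [leRHS]mulrDl mul1r lerDl mulr_ge0 //.
    exact: le_trans P2.
  by rewrite addr_ge0 //; exact: le_trans L0L.
have hyP : 0 <= - ln p0 <= P.
  by rewrite y0 /=; apply: le_trans yP; rewrite lerDr.
have hF : 0 < F <= (b' * (`|ln cd'| + 1 + kd) + 1) * (P * (1 + - ln delta)).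
  by rewrite F0.
have := hL0 _ _ _ _ _ L0L hyP P2 hF hK.
have -> : (N * Ns)%:R * expR (- (2 * (- ln p0) + 2 * (- ln delta))) /
    (ka * F ^+ 2) = (N * Ns)%:R * (p0 * delta / tc) ^+ 2 / (16 * F ^+ 2).
  have -> : expR (- (2 * (- ln p0) + 2 * (- ln delta))) = (p0 * delta) ^+ 2.
    rewrite exprMn -{2}[p0](lnK (_ : _ \is Num.pos)) ?posrE //.
    rewrite -{2}[delta](lnK (_ : _ \is Num.pos)) ?posrE //.
    by rewrite -!expRM_natl -expRD; congr expR; ring.
  by rewrite kaE; field; rewrite tc0 gt_eqF.
set Zx := (_ * _ ^+ 2) / _; clearbody Zx => main.
rewrite expRN ler_pdivrMr ?expR_gt0 //.
have K_ge : N%:R <= (N * Ns)%:R :> R by rewrite ler_nat leq_pmulr.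
have N2 : 2 <= N%:R :> R by rewrite ler_nat.
have K0 : 0 < (N * Ns)%:R :> R by rewrite ltr0n muln_gt0 Ns0 ltnW.
move: (N * Ns)%:R main K_ge K0 => K main K_ge K0.
have X0 : 0 < expR P by exact: expR_gt0.
have J6 : (levels eps)%:R <= 6 * expR P.
  apply: le_trans (levels_le he) _; apply: ler_wpM2l => //.
  exact: le_expR_norm_ln.
(* Beside the 432 from the grid, 2 + N <= 2 N <= 4 N F / p0, by N >= 2, F >= 1/2 and p0 <= 1. *)
have T440 : (G.+1 + N)%:R <= 440 * (K * F * expR P) :> R.
  have h1 : N%:R * F / p0 <= K * F * expR P.
    rewrite -!mulrA; apply: ler_pM => //; first by rewrite divr_ge0 // ltW.
    by rewrite ler_pM2l // le_expR_norm_ln.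
  have h2 : N%:R * F <= N%:R * F / p0.
    by rewrite ler_pdivlMr // ger_pMr // mulr_gt0 // (lt_le_trans _ N2).
  have h3 : N%:R <= 2 * (N%:R * F) by clear -F1 N2; nra.
  rewrite natrD -natr1.
  move: (N%:R * F / p0) (N%:R * F) (K * F * expR P) h1 h2 h3 hG.
  by move=> q1 q2 q3 h1 h2 h3 hG; clear -h1 h2 h3 hG N2; lra.
have etaP' : expR (- P) <= eta.
  rewrite expRN -[eta]invrK lef_pV2 ?posrE ?invr_gt0 //.
  exact: le_expR_norm_ln.
apply: (@le_trans _ _ (expR (- P) * (ka * expR (3 * P) * K * F))); last first.
  apply: ler_pM; [exact: expR_ge0| |exact: etaP'|exact: main].
  have ka0 : 0 <= ka by exact: le_trans ka1.
  by rewrite !mulr_ge0 ?expR_ge0 // ltW.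
have -> : expR (- P) * (ka * expR (3 * P) * K * F) =
    ka * (expR P * (K * F * expR P)).
  by rewrite expRN expRM_natl; field; rewrite gt_eqF.
rewrite natrM.
apply: (@le_trans _ _ (4 * ((6 * expR P) * (440 * (K * F * expR P))))).
  by apply: ler_wpM2l => //; apply: ler_pM.
have -> : 4 * ((6 * expR P) * (440 * (K * F * expR P))) =
  4 * 6 * 440 * (expR P * (K * F * expR P)) by ring.
have XK0 : 0 <= expR P * (K * F * expR P).
  by apply: mulr_ge0; [|apply: mulr_ge0; [apply: mulr_ge0|]]; apply: ltW.
by apply: ler_wpM2r => //; clear -kaE tc26; nra.
Qed.

End FailureBound.

(** * From the concentration event to the accuracy of the output *)

Section Success.
Context {R : realType} (d : nat) (Fhat : 'I_(d.*2.+1) -> R[i]).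

Lemma cabs_trig_eval_le x : cabs (trig_eval Fhat x) <= coef_norm Fhat.
Proof.
apply: le_trans (cabs_sum _ _ _) _; apply: ler_sum => s _.
by rewrite cabsM cabs_expi mulr1.
Qed.

Lemma cabs_shot_mean_le amp step j n : (forall t, cabs (amp t) <= 1) ->
  cabs (shot_mean Fhat amp step j n) <= coef_norm Fhat.
Proof.
move=> amp1; apply: le_trans (cabs_sum _ _ _) _; apply: ler_sum => s _.
by rewrite cabsM ler_piMr // cabs_ge0.
Qed.

Lemma cabs_filtered_data_le J Ns N phi (w : sample d J Ns N) i n :
  (0 < Ns)%N -> 0 < coef_norm Fhat ->
  cabs (filtered_data Fhat phi w i n) <= 2 * coef_norm Fhat.
Proof.
move=> Ns0 F0; have Ns0' : 0 < Ns%:R :> R by rewrite ltr0n.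
rewrite /filtered_data cabsM cabs_real gtr0_norm ?invr_gt0 //.
rewrite ler_pdivrMl //; apply: le_trans (cabs_sum _ _ _) _.
apply: le_trans (ler_sum _ (fun k _ => cabs_shot_value _ F0 _)) _.
by rewrite sumr_const card_ord -[leLHS]mulr_natl.
Qed.

(** A filter close to 1 at one point has coefficient norm close to at least 1; this keeps F above
    1/2. *)
Lemma coef_norm_ge x q : cabs (trig_eval Fhat x - 1) <= q ->
  1 - q <= coef_norm Fhat.
Proof.
move=> hq; have h := cabs_trig_eval_le x.
have : cabs (trig_eval Fhat x - (trig_eval Fhat x - 1)) <= coef_norm Fhat + q.
  by apply: le_trans (cabsB _ _) _; exact: lerD.
by rewrite opprB addrC subrK cabs_real normr1 lerBlDr.
Qed.

End Success.

(* [t = p0 delta / tc] is the Chernoff deviation; [8640 < tc] makes the bound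
   [4320 * (2 t)] of [level_estimate] smaller than [p0 delta], and [2 / tc]
   leaves room for the deterministic error [5 p0 delta^2]. *)
Lemma success_probability (R : realType) (M : nat)
    (v : 'I_M.+1 -> 'cV[R[i]]_M.+1) (lam : 'I_M.+1 -> R)
    (psi : 'cV[R[i]]_M.+1) (I I' : set R) (tc eta eps delta q a a' b b' : R)
    (d : nat) (Fhat : 'I_(d.*2.+1) -> R[i]) (phi : 'I_(d.*2.+1) -> R)
    (N Ns G : nat) :
  let p0 := overlap v psi ord0 in
  let pr := relative_overlap v lam psi I I' in
  let J := levels eps in
  let step := tau delta eps N in
  let F := coef_norm Fhat in
  (forall m m', braket (v m) (v m') = (m == m')%:R) ->
  braket psi psi = 1 ->
  (forall m, - pi <= lam m <= pi) ->
  0 < p0 -> I `<=` I' -> I (lam ord0) ->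
  0 < eps < 1 / 2 -> 8640 < tc -> 0 < delta <= 1 / 2 ->
  5 * delta <= 2 / tc -> pi + 2 * pi * delta <= 4 ->
  1 - pr <= delta ^+ 2 -> 1 - pr <= 1 / 2 ->
  0 <= q <= p0 * delta ^+ 2 -> q <= 1 / 2 ->
  fourier_filter I I' q a a' b b' Fhat ->
  (forall s, Fhat s = (cabs (Fhat s))%:C * expi (phi s)) ->
  (1 < N)%N -> (0 < Ns)%N -> (0 < G)%N ->
  432 * (N%:R * F / p0) <= G%:R ->
  4 * (J * (G.+1 + N))%:R *
    expR (- ((N * Ns)%:R * (p0 * delta / tc) ^+ 2 / (16 * F ^+ 2))) <= eta ->
  forall (r : sample d J Ns N -> nat -> R[i])
         (theta : sample d J Ns N -> nat -> R),
  (forall w, qcels_run step (theta w) (filtered_data Fhat phi w) (r w)) ->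
  1 - eta <= prob Fhat (evol_amp v lam psi) step
    (fun w => `|symmod pi (theta w J - lam ord0)| < eps).
Proof.
move=> p0 pr J step F orth psi1 lamb p0_gt0 II' I0 he htc hd hdtc hdpi hpr hpr2.
move=> hq q2 hF FE N1 Ns0 G0 hG heta r theta hrun.
have [q0 qp] := andP hq; have [d0 d2] := andP hd.
have N0 : (0 < N)%N by rewrite ltnW.
set amp := evol_amp v lam psi.
have amp1 t : cabs (amp t) <= 1 by exact: cabs_evol_amp_le1.
have amp_Re t : `|complex.Re (amp t)| <= 1.
  exact: le_trans (normr_Re_le _) (amp1 t).
have amp_Im t : `|complex.Im (amp t)| <= 1.
  exact: le_trans (normr_Im_le _) (amp1 t).
have tc0 : 0 < tc by clear -htc; lra.
have p01 : p0 <= 1 by exact: (overlap_le1 lam orth psi1 ord0).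
have F_half : 1 / 2 <= F.
  by apply: le_trans (coef_norm_ge (ff_pass hF I0)); clear -q2; lra.
have F0 : 0 < F by clear -F_half; lra.
pose t := p0 * delta / tc.
have t0 : 0 < t by rewrite divr_gt0 // mulr_gt0.
have tp : 72 * t <= p0.
  have -> : 72 * t = p0 * (72 * delta / tc) by rewrite /t; ring.
  rewrite ger_pMr // ler_pdivrMr // mul1r.
  by clear -htc d2 d0; lra.
have t_half : t <= 1 / 2 by clear -tp p01 t0; lra.
have tF : t <= F by exact: le_trans F_half.
pose ga := 2 * t.
have ga0 : 0 < ga by rewrite mulr_gt0.
have gap : 36 * ga <= p0 by rewrite /ga mulrA -natrM.
(* Test weights for a single union bound: Fourier modes on the grid and indicators of tails, all
   carrying the phase of [lam ord0]. *)
pose u (i : 'I_J) (x : 'I_G.+1 + 'I_N) (n : nat) : R[i] :=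
  match x with
  | inl g => expi (n%:R * grid_point G g)
  | inr m => (m <= n)%N%:R
  end * expi (lam ord0 * n%:R * step i.+1).
have u1 i x n : cabs (u i x n) <= 1.
  rewrite /u cabsM cabs_expi mulr1; case: x => [g|m].
    by rewrite cabs_expi.
  by rewrite cabs_natr lern1 leq_b1.
have := deviation_union_le step F0 amp_Re amp_Im FE N0 Ns0 u1 (ltW t0) tF.
rewrite card_sum !card_ord => hdev.
apply: le_trans (_ : 1 - eta <= _) (le_trans hdev _).
  by rewrite lerD2l lerN2.
(* From here on [w] is fixed in the good event and the argument is deterministic. *)
apply: prob_mono => // w /forallP hw.
have fin : N%:R * `|(theta w J - lam ord0) * step J| < delta.
  have J1 : (1 < J)%N by exact: levels_gt1.
  have hs0 j : 0 < step j by exact: tau_gt0.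
  apply: (qcels_error N1 J1 hs0 _ _ hd hdpi (lamb ord0) _ (hrun w)).
  - by move=> j; exact: tauS.
  - exact: tau1_le.
  move=> i lo hi th z hmin hlam hx.
  pose Zm (n : 'I_N) := shot_mean Fhat amp step i.+1 n.
  pose dp := @dephased R N (lam ord0) (step i.+1).
  pose e1 n := dp Zm n - p0%:C.
  pose e2 n := dp (filtered_data Fhat phi w i) n - dp Zm n.
  have dpE : dp (filtered_data Fhat phi w i) = fun n => p0%:C + (e1 n + e2 n).
    by apply: funext => n; rewrite /e1 /e2; ring.
  have hmax := loss_argmin_fourier_mean N0 hmin hlam.
  rewrite -/dp dpE in hmax.
  have he1 n : cabs (e1 n) <= ga.
    rewrite /e1 /dp /dephased /Zm dephased_shot_mean //.
    have hP : (lam ord0 \in I') by rewrite mem_set //; exact: II'.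
    have hq1 : 0 <= q <= 1 by rewrite q0 /=; clear -q2; lra.
    have := @signal_error_le R M v lam psi orth psi1
      (fun m => trig_eval Fhat (lam m))
      (fun m => expi ((lam ord0 - lam m) * n%:R * step i.+1))
      (fun m => lam m \in I') q hq1 hP (ff_pass hF I0).
    move=> /(_ _ _ _ _)/le_trans; apply.
    - by rewrite subrr !mul0r expi0.
    - by move=> m; rewrite cabs_expi.
    - by move=> m; exact: ff_bound hF _ (lamb m).
    - move=> m /negP hm; apply: (ff_stop hF (lamb m)) => Im; apply: hm.
      by rewrite mem_set.
    have := trapped_weight_le II' I0 p0_gt0 hpr2; rewrite -/p0 -/pr => hS.
    (* One p0 delta^2 comes from [q], four from twice the trapped weight. *)
    apply: (@le_trans _ _ (p0 * delta ^+ 2 + 2 * (2 * p0 * delta ^+ 2))).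
      apply: lerD => //; apply: ler_wpM2l => //; apply: le_trans hS _.
      by apply: ler_wpM2l => //; rewrite mulr_ge0 // ltW.
    have -> : p0 * delta ^+ 2 + 2 * (2 * p0 * delta ^+ 2) =
        p0 * delta * (5 * delta) by ring.
    have -> : ga = p0 * delta * (2 / tc) by rewrite /ga /t; ring.
    by apply: ler_wpM2l => //; rewrite ltW // mulr_gt0.
  have he2 n : cabs (e2 n) <= 3 * F.
    apply: le_trans (cabsB _ _) _.
    have -> : 3 * F = 2 * F + F by ring.
    have cdp Z : cabs (dp Z n) = cabs (Z n).
      by rewrite /dp /dephased cabsM cabs_expi mulr1.
    rewrite !cdp; apply: lerD; first exact: cabs_filtered_data_le.
    exact: cabs_shot_mean_le.
  have he2u x : cabs (weighted_mean (u i x) (filtered_data Fhat phi w i) -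
      weighted_mean (u i x) Zm) <= ga by have /forallP := hw i; apply.
  have hgrid (g : 'I_G.+1) : cabs (fourier_mean e2 (grid_point G g)) <= ga.
    have := he2u (inl g); rewrite /u -!weighted_mean_dephased.
    by rewrite weighted_mean_sub.
  have htail (m : 'I_N) :
      cabs (weighted_mean (fun n => (m <= n)%N%:R) e2) <= ga.
    have := he2u (inr m); rewrite /u -!weighted_mean_dephased.
    by rewrite weighted_mean_sub.
  have := level_estimate N1 G0 p0_gt0 ga0 gap hG he1 he2 hgrid htail hx hmax.
  have -> : 4320 * ga = delta * p0 * (8640 / tc) by rewrite /ga /t; ring.
  move=> hle; rewrite -(ltr_pM2r p0_gt0); apply: le_lt_trans hle _.
  have dp0 : 0 < delta * p0 by exact: mulr_gt0.
  by rewrite (gtr_pMr _ dp0) (ltr_pdivrMr _ _ tc0) mul1r; exact: htc.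
have herr : `|theta w J - lam ord0| < eps.
  rewrite [ltRHS](tau_levels_eps he d0 N0) ltr_pdivlMr; last first.
    by rewrite mulr_gt0 ?ltr0n // tau_gt0.
  move: fin; rewrite normrM (gtr0_norm (tau_gt0 _ _ _ _)) // -/step -/J.
  by rewrite mulrCA.
rewrite symmod_small //; apply: lt_trans herr _; by case/andP: he.
Qed.

(** * Choice of the constants and assembly *)

Theorem theorem12 (R : realType) :
  (* lower constant for delta, upper constant for q *)
  exists cdelta cq' : R, 0 < cdelta /\ 0 < cq' /\
  (* all other constants of the Theta hypotheses are arbitrary *)
  forall cdelta' cq cd cd' kd a a' b b' : R,
  cdelta <= cdelta' -> 0 < cq <= cq' -> 0 < cd <= cd' -> 0 <= kd ->
  0 < a <= a' -> 0 < b <= b' ->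
  (* constants and exponents of the Omega hypotheses, threshold for zeta *)
  exists C1 k1 C2 k2 zeta0 : R,
  0 < C1 /\ 0 <= k1 /\ 0 < C2 /\ 0 <= k2 /\ 0 < zeta0 /\
  forall C1' : R, C1 <= C1' ->
  exists cT cT' : R, 0 < cT /\ 0 < cT' /\
  forall zeta : R, 0 < zeta < zeta0 ->
  (* how close p_r has to be to 1 *)
  exists c0 : R, 0 < c0 /\
  forall (M : nat) (H : 'M[R[i]]_M.+1)
    (v : 'I_M.+1 -> 'cV[R[i]]_M.+1) (lam : 'I_M.+1 -> R)
    (psi : 'cV[R[i]]_M.+1) (I I' : set R)
    (eta eps delta q : R) (d : nat)
    (Fhat : 'I_(d.*2.+1) -> R[i]) (phi : 'I_(d.*2.+1) -> R) (N Ns : nat),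
  let p0 := overlap v psi ord0 in
  let pr := relative_overlap v lam psi I I' in
  let D := gap I I' in
  let J := levels eps in
  let step := tau delta eps N in
  H \is hermsymmx ->
  eigenbasis H v lam ->
  (forall m, - pi <= lam m <= pi) ->
  (forall m, lam ord0 <= lam m) ->
  lam ord0 < pi ->
  braket psi psi = 1 ->
  0 < p0 ->
  is_interval I -> is_interval I' ->
  I `<=` I' -> I' `<=` `[- pi, pi]%classic ->
  I (lam ord0) ->
  0 < D ->
  0 < eta < 1 ->
  0 < eps < 1 / 2 ->
  0 < delta ->
  cdelta * Num.sqrt (1 - pr) <= delta <= cdelta' * Num.sqrt (1 - pr) ->
  1 - pr <= c0 ->
  cd * (D^-1 * polylog kd [:: p0^-1; delta^-1]) <= d%:R
    <= cd' * (D^-1 * polylog kd [:: p0^-1; delta^-1]) ->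
  cq * (p0 * delta ^+ 2) <= q <= cq' * (p0 * delta ^+ 2) ->
  fourier_filter I I' q a a' b b' Fhat ->
  (forall s, Fhat s = (cabs (Fhat s))%:C * expi (phi s)) ->
  (0 < N)%N -> (0 < Ns)%N ->
  C1 * product_bound k1 p0 delta zeta eps D eta <= (N * Ns)%:R ->
  C2 * min_bound k2 p0 eps D eta <= (minn N Ns)%:R ->
  [/\ forall (r : sample d J Ns N -> nat -> R[i])
             (theta : sample d J Ns N -> nat -> R),
        (forall w, qcels_run step (theta w) (filtered_data Fhat phi w) (r w)) ->
        1 - eta <=
          prob Fhat (evol_amp v lam psi) step
            (fun w => `|symmod pi (theta w J - lam ord0)| < eps),
      eps = delta / (N%:R * step J),
      T_max d J N step = d%:R + delta / eps
    & (N * Ns)%:R <= C1' * product_bound k1 p0 delta zeta eps D eta ->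
      cT * product_bound k1 p0 delta zeta eps D eta * (d%:R + delta / eps)
        <= T_total d J Ns N step
        <= cT' * product_bound k1 p0 delta zeta eps D eta
             * (J%:R * d%:R + delta / eps) ].
Proof.
have pi4 : 0 < 4 - pi :> R by have := @pihalf_lt2 R; lra.
(* These yield 1 - p_r <= delta^2 and q <= p0 delta^2. *)
exists 1, 1; split=> //; split=> //.
move=> cdelta' cq cd cd' kd a a' b b' hcdelta /andP[cq0 _] /andP[cd0 cdd] kd0.
move=> _ /andP[b0 bb].
(* The exponent 3 is that of [sample_size_suffices]; [C2 = 2] with exponent 0 yields N >= 2, and
   zeta < 1. *)
exists 1, 3, 2, 0, 1; do 5 (split=> //).
move=> C1' hC1; exists (1 / 2), (2 * C1').
have C1'0 : 0 < C1' by exact: lt_le_trans hC1.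
split; first exact: divr_gt0.
split; first exact: mulr_gt0.
move=> zeta /andP[z0 z1].
have [tc htc] : exists tc : R, 8640 < tc by exists (8640 + 1); rewrite ltrDl.
have tc26 : 26 <= tc by clear -htc; lra.
have tc0 : 0 < tc by clear -tc26; lra.
have cd'0 : 0 < cd' by exact: lt_le_trans cdd.
have b'0 : 0 < b' by exact: lt_le_trans bb.
have z01 : 0 < zeta <= 1 by rewrite z0 ltW.
have [delta0 /andP[de0 de1] hfail] := failure_bound tc26 cd'0 kd0 b'0 z01.
have pi0 := @pi_gt0 R.
(* The upper limits on delta: for the failure bound, for the deterministic error, for the bound 1/2,
   and for offsets of at most pi + 2 pi delta <= 4. *)
pose dm := Num.min delta0
  (Num.min (2 / (5 * tc)) (Num.min (1 / 2) ((4 - pi) / (2 * pi)))).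
have dm0 : 0 < dm by rewrite !lt_min de0 !divr_gt0 ?mulr_gt0.
have cdelta'0 : 0 < cdelta' by exact: lt_le_trans hcdelta.
(* 1/2 serves the trapped weight; the square forces delta <= dm through the upper bound on delta. It
   depends on zeta through [delta0]. *)
exists (Num.min (1 / 2) ((dm / cdelta') ^+ 2)).
split; first by rewrite lt_min divr_gt0 // exprn_gt0 // divr_gt0.
move=> M H v lam psi I I' eta eps delta q d Fhat phi N Ns p0 pr D J step.
move=> _ [orth _] lamb _ _ psi1 p0_gt0 _ _ II' _ I0 D0 heta heps d0.
move=> /andP[hdelta1 hdelta2] hpr /andP[_ hd] /andP[hq1 hq2] hF FE N0 Ns0 hK hmin.
rewrite mul1r in hdelta1; rewrite !mul1r in hq2 hK.
have p01 : p0 <= 1 by exact: (overlap_le1 lam orth psi1 ord0).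
have [hpr2 hprd] : 1 - pr <= 1 / 2 /\ 1 - pr <= (dm / cdelta') ^+ 2.
  by move: hpr; rewrite le_min => /andP[].
have ddm : delta <= dm.
  apply: le_trans hdelta2 _.
  have : Num.sqrt (1 - pr) <= dm / cdelta'.
    rewrite -[leRHS]gtr0_norm ?divr_gt0 // -sqrtr_sqr.
    exact: ler_wsqrtr.
  by rewrite ler_pdivlMr // mulrC.
have [hdd0 hdtc hdh hdpi] : [/\ delta <= delta0, delta <= 2 / (5 * tc),
    delta <= 1 / 2 & delta <= (4 - pi) / (2 * pi)].
  by move: ddm; rewrite !le_min => /and4P[].
have hpr3 : 1 - pr <= delta ^+ 2.
  have [pr1|pr1] := leP (1 - pr) 0; first exact: le_trans (sqr_ge0 _).
  by rewrite -(sqr_sqrtr (ltW pr1)) ler_pXn2r ?nnegrE ?sqrtr_ge0 ?(ltW d0).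
have q0 : 0 <= q.
  by apply: le_trans hq1; do 2 (apply: mulr_ge0; first exact: ltW); exact: sqr_ge0.
have d2_le : delta ^+ 2 <= 1 / 2.
  by clear -d0 hdh; nra.
have q2 : q <= 1 / 2.
  apply: le_trans hq2 _; apply: le_trans d2_le.
  by rewrite ler_piMl // sqr_ge0.
have N1 : (1 < N)%N.
  have p2 : 1 <= p0 ^- 2.
    by rewrite -exprVn; apply: exprn_ege1; rewrite invf_ge1.
  move: hmin; rewrite /min_bound /polylog powRr0 mulr1 => hmin.
  have : 2 <= (minn N Ns)%:R :> R.
    by apply: le_trans hmin; rewrite ler_peMr.
  by rewrite ler_nat leq_min => /andP[].
set F := coef_norm Fhat.
have F_half : 1 / 2 <= F.
  by apply: le_trans (coef_norm_ge (ff_pass hF I0)); clear -q2; lra.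
have F0 : 0 < F by apply: lt_le_trans F_half; exact: divr_gt0.
have Fd : 1 / 2 <= F <= b' * ln d%:R.
  by rewrite F_half; case/andP: (ff_sum hF).
(* Large enough for the interpolation, and within 1 of that size for the union bound. *)
pose G := (Num.trunc (432 * (N%:R * F / p0))).+1.
have NFp0 : 0 <= 432 * (N%:R * F / p0).
  apply: mulr_ge0; first exact: ler0n.
  by apply: divr_ge0; [apply: mulr_ge0; [exact: ler0n|exact: ltW]|exact: ltW].
have /andP[hG1 hG2] := truncn_itv NFp0.
have hGle : G%:R <= 432 * (N%:R * F / p0) + 1.
  rewrite /G -[leLHS]natr1 lerD2r; exact: hG1.
have p0in : 0 < p0 <= 1 by rewrite p0_gt0.
have din : 0 < delta <= delta0 by rewrite d0.
have hfin := hfail _ _ _ _ _ _ _ _ _ _ p0in din heps D0 heta Fd hd N1 Ns0 hK hGle.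
split.
- have dh : 0 < delta <= 1 / 2 by rewrite d0.
  have h5 : 5 * delta <= 2 / tc.
    by move: hdtc; rewrite invfM mulrCA mulrC ler_pdivlMr // mulrC.
  have hp4 : pi + 2 * pi * delta <= 4.
    have : delta * (2 * pi) <= 4 - pi by rewrite -ler_pdivlMr ?mulr_gt0.
    by clear; lra.
  have hqin : 0 <= q <= p0 * delta ^+ 2 by rewrite q0.
  exact: (success_probability orth psi1 lamb p0_gt0 II' I0 heps htc dh h5 hp4
    hpr3 hpr2 hqin q2 hF FE N1 Ns0 (ltn0Sn _) (ltW hG2) hfin).
- exact: tau_levels_eps.
- exact: T_maxE.
move=> hK'; have /andP[T1 T2] := T_total_bounds heps d0 N0 d Ns N1.
have de0' : 0 <= delta / eps by rewrite divr_ge0 ?ltW //; case/andP: heps.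
apply/andP; split.
  apply: le_trans T1; apply: ler_wpM2r; first by rewrite addr_ge0.
  by rewrite mul1r [leLHS]mulrC ler_pM2r // invr_gt0.
apply: le_trans T2 _; apply: ler_wpM2r.
  by rewrite addr_ge0 // mulr_ge0.
by rewrite -[leRHS]mulrA ler_wpM2l.
Qed.
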